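(* Let $\phi_1,\phi_2$ be real with $|\phi_2|<1$, $\phi_1+\phi_2<1$, $\phi_2-\phi_1<1$, let $\sigma^2>0$, and let $(z_t)_{t\in\mathbb Z}$ be the stationary mean-zero AR(2) process $z_t=\phi_1 z_{t-1}+\phi_2 z_{t-2}+a_t$, where the $a_t$ are independent $N(0,\sigma^2)$ random variables. Let $\hat\phi_1,\hat\phi_2$ be the Burg estimators (known zero mean case) computed from $z_1,\dots,z_n$. Then, as $n\to\infty$, $$E(\hat\phi_1-\phi_1)=-\frac{\phi_1}{n}+o\!\left(\frac1n\right),\qquad E(\hat\phi_2-\phi_2)=-\frac{1+3\phi_2}{n}+o\!\left(\frac1n\right).$$
   Context: The AR(2) process is the (causal) stationary solution, so $a_t$ is independent of $z_s$ for $s<t$. The Burg estimators based on $z_1,\dots,z_n$ with known mean zero are $$\hat\phi_2=1-\frac{CD^2-2ED^2}{CD^2+8F^2G-4FHD},\qquad \hat\phi_1=\frac{2F}{D}(1-\hat\phi_2),$$ where $$C=\frac1{n-2}\sum_{t=3}^n(z_t^2+z_{t-2}^2),\quad D=\frac1{n-1}\sum_{t=2}^n(z_t^2+z_{t-1}^2),\quad E=\frac1{n-2}\sum_{t=3}^n z_tz_{t-2},$$ $$F=\frac1{n-1}\sum_{t=2}^n z_tz_{t-1},\quad G=\frac1{n-2}\sum_{t=3}^n z_{t-1}^2,\quad H=\frac1{n-2}\sum_{t=3}^n(z_tz_{t-1}+z_{t-2}z_{t-1}).$$ (The statistic $E$ in these formulas is not to be confused with the expectation operator $E(\cdot)$ in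 the claim.) *)

(* Defs.v *)
From HB Require Import structures.
From mathcomp Require Import all_boot all_order all_algebra.
From mathcomp Require Import all_classical all_reals all_analysis.

Set Implicit Arguments.
Unset Strict Implicit.
Unset Printing Implicit Defensive.

Import Order.TTheory GRing.Theory Num.Theory.
Import numFieldNormedType.Exports.

Local Open Scope classical_set_scope.
Local Open Scope ring_scope.

(* Mutual independence: the product rule over every finite subfamily. *)
Definition mutually_independent d (T : measurableType d) (R : realType)
    (P : probability T R) (I : choiceType) (X : I -> {RV P >-> R}) : Prop :=
  forall (s : seq I) (B : I -> set R), uniq s ->
    (forall i, measurable (B i)) ->
    (P (\bigcap_(i in [set` s]) X i @^-1` B i)
     = \prod_(i <- s) P (X i @^-1` B i))%E.

Definition sigma_past d (T : measurableType d) (R : realType)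
    (P : probability T R) (z : int -> {RV P >-> R}) (t : int) : set (set T) :=
  <<s \bigcup_(s in [set s : int | s < t])
        preimage_set_system setT (z s) measurable >>.

Definition independent_of_past d (T : measurableType d) (R : realType)
    (P : probability T R) (z a : int -> {RV P >-> R}) : Prop :=
  forall (t : int) (A : set T) (B : set R),
    sigma_past z t A -> measurable B ->
    P (A `&` a t @^-1` B) = (P A * P (a t @^-1` B))%E.

(* Covariance (second-order) stationarity; finite second moments make the
   means and covariances meaningful. *)
Definition weakly_stationary d (T : measurableType d) (R : realType)
    (P : probability T R) (z : int -> {RV P >-> R}) : Prop :=
  [/\ forall t, (z t : T -> R) \in Lfun P 2%:E,
      forall s t, ('E_P[z s] = 'E_P[z t])%E
    & forall s t h : int,
        covariance P (z (s + h)) (z (t + h)) = covariance P (z s) (z t)].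

(* The causal stationary mean-zero Gaussian AR(2) process z driven by the noise
   a.  normal_prob is parametrised by the standard deviation.  Equalities of
   random variables are almost sure. *)
Record causal_stationary_AR2 d (T : measurableType d) (R : realType)
    (P : probability T R) (phi1 phi2 sigma : R)
    (z a : int -> {RV P >-> R}) : Prop := CausalStationaryAR2 {
  AR2_noise_indep : mutually_independent a ;
  AR2_noise_normal : forall (t : int) (B : set R), measurable B ->
    distribution P (a t) B = normal_prob 0 sigma B ;
  AR2_stationary : weakly_stationary z ;
  AR2_mean0 : forall t : int, ('E_P[z t] = 0)%E ;
  AR2_recursion : forall t : int, {ae P, forall w,
    z t w = phi1 * z (t - 1) w + phi2 * z (t - 2) w + a t w} ;
  AR2_causal : independent_of_past z a }.

(* Only the values x_1, ..., x_n of the path x are used. *)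
Section Burg.
Context (R : realType) (x : int -> R) (n : nat).

Definition burgC : R :=
  (n%:R - 2)^-1 * \sum_(3 <= t < n.+1) (x t%:Z ^+ 2 + x (t%:Z - 2) ^+ 2).

Definition burgD : R :=
  (n%:R - 1)^-1 * \sum_(2 <= t < n.+1) (x t%:Z ^+ 2 + x (t%:Z - 1) ^+ 2).

Definition burgE : R :=
  (n%:R - 2)^-1 * \sum_(3 <= t < n.+1) x t%:Z * x (t%:Z - 2).

Definition burgF : R :=
  (n%:R - 1)^-1 * \sum_(2 <= t < n.+1) x t%:Z * x (t%:Z - 1).

Definition burgG : R :=
  (n%:R - 2)^-1 * \sum_(3 <= t < n.+1) x (t%:Z - 1) ^+ 2.

Definition burgH : R :=
  (n%:R - 2)^-1 * \sum_(3 <= t < n.+1)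
    (x t%:Z * x (t%:Z - 1) + x (t%:Z - 2) * x (t%:Z - 1)).

(* Total division: the denominators vanish only on a null event for n >= 3. *)
Definition burg_phi2 : R :=
  1 - (burgC * burgD ^+ 2 - 2 * burgE * burgD ^+ 2)
      / (burgC * burgD ^+ 2 + 8 * burgF ^+ 2 * burgG
         - 4 * burgF * burgH * burgD).

Definition burg_phi1 : R := 2 * burgF / burgD * (1 - burg_phi2).

End Burg.

(* Main.v *)
(* Put e_t = z_t - phi1 z_{t-1} - phi2 z_{t-2}, which equals a_t almost
   surely and is independent of the past.  Up to edge terms of size 1/n, the sample
   autocovariances satisfy the Yule-Walker equations perturbed by the averages U1,
   U2, V of e_t z_{t-1}, e_t z_{t-2} and e_t^2 - E e_t^2; so their fluctuations are,
   at first order, linear in (U1, U2, V).  These are normalised sums of martingale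
   differences: their covariances are explicit and E (sum)^4 = O(n^2).

   The Burg reflection coefficient r solves r D = 2 F with |r| <= 1, and the
   estimator of phi2 solves  p Q = N  with |p| <= 1, where Q and N are polynomials
   in r and the statistics.  Substituting each such equation twice into itself gives
   a second order expansion whose remainder is a product of three factors of size
   n^{-1/2}, hence O(n^{-3/2}) in L^1; the bounds on r and p give that size for the
   errors r - rho and p - phi2, including the event where a denominator is small.
   Here rho = phi1 / (1 - phi2).  The first order terms have mean exactly 0 and the
   second order terms give the bias.

   Moments of z are not assumed: they come from the quadratic form
   x^2 - 2 rho x y + y^2, which the AR(2) recursion contracts in two steps. *)

Require Import Defs.
From HB Require Import structures.
From mathcomp Require Import all_boot all_order all_algebra.
From mathcomp Require Import all_classical all_reals all_analysis.
From mathcomp Require Import measurable_realfun ring lra zify.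

Set Implicit Arguments.
Unset Strict Implicit.
Unset Printing Implicit Defensive.

Import Order.TTheory GRing.Theory Num.Theory.
Import numFieldNormedType.Exports.

Local Open Scope classical_set_scope.
Local Open Scope ring_scope.

(** * Random variables with uniformly bounded moments *)

(** Expanding the estimators as quotients would call for inverse moments of D and Q, that is, for
    small-ball estimates. Each error is instead kept in an implicit equation with a constant
    divisor, [dl = (nu - dl cD) / (2 g0)] and [tau = (L - tau q) / q0], and the a priori bounds on
    [dl] and [tau] start the iteration. Edge terms are of size 1/n, the order of the bias itself.
    Inside a mean the first order parts are therefore not linearised: they stay written in the
    statistics, which are exactly unbiased at every n. Linearisation is confined to products, and
    there V meets only U1 and U2, to which it is orthogonal, so its variance never has to be
    computed. Two cancellations keep the algebra small: the r-derivative of [N - phi2 Q] at rho has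
    mean 0, because g1 = rho g0; and the first order errors of the two reflection coefficients are
    uncorrelated. The moment recursion for z is iterated on truncated variables, since with a
    possibly infinite moment on both sides the inequality would say nothing. *)

Lemma normrD_pow_le (R : realDomainType) (k : nat) (x y : R) :
  `|x + y| ^+ k <= 2 ^+ k * (`|x| ^+ k + `|y| ^+ k).
Proof.
apply: le_trans (_ : (2 * Num.max `|x| `|y|) ^+ k <= _).
  rewrite lerXn2r// ?nnegrE// ?mulr_ge0// ?le_max ?normr_ge0//.
  rewrite (le_trans (ler_normD _ _))// mulr2n mulrDl mul1r.
  by rewrite lerD// le_max lexx ?orbT.
rewrite exprMn ler_wpM2l ?exprn_ge0//.
by rewrite /Num.max; case: ifP => _; rewrite ?lerDl ?lerDr exprn_ge0.
Qed.

Section UniformMoments.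
Context {d : measure_display} {T : measurableType d} {R : realType}.
Variable P : probability T R.

(** All orders are bundled because the class is then closed under products: expectations of
    arbitrary polynomials in such variables are linear without any tracking of exponents. *)
Definition umom (I : Type) (f : I -> T -> R) : Prop :=
  (forall i, measurable_fun setT (f i)) /\
  forall k : nat, exists K : R,
    forall i, (\int[P]_w (`|f i w| ^+ k)%:E <= K%:E)%E.

Definition mom (f : T -> R) : Prop := umom (fun _ : unit => f).

Lemma ge0_le_integral_EFin (f g : T -> R) :
  measurable_fun setT f -> measurable_fun setT g ->
  (forall w, 0 <= f w <= g w) ->
  (\int[P]_w (f w)%:E <= \int[P]_w (g w)%:E)%E.
Proof.
move=> mf mg fg; apply: ge0_le_integral => //=.
- by move=> w _; rewrite lee_fin; case/andP: (fg w).
- exact/measurable_EFinP.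
- exact/measurable_EFinP.
- by move=> w _; rewrite lee_fin; case/andP: (fg w).
Qed.

Lemma ge0_integralD_EFin (f g : T -> R) :
  measurable_fun setT f -> measurable_fun setT g ->
  (forall w, 0 <= f w) -> (forall w, 0 <= g w) ->
  (\int[P]_w (f w + g w)%:E = \int[P]_w (f w)%:E + \int[P]_w (g w)%:E)%E.
Proof.
move=> mf mg f0 g0; under eq_integral do rewrite EFinD.
apply: ge0_integralD => //.
- by move=> w _; rewrite lee_fin.
- exact/measurable_EFinP.
- by move=> w _; rewrite lee_fin.
- exact/measurable_EFinP.
Qed.

Lemma ge0_integralZl_EFin (c : R) (f : T -> R) :
  measurable_fun setT f -> (forall w, 0 <= f w) -> 0 <= c ->
  (\int[P]_w (c * f w)%:E = c%:E * \int[P]_w (f w)%:E)%E.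
Proof.
move=> mf f0 c0; under eq_integral do rewrite EFinM.
apply: ge0_integralZl => //.
- exact/measurable_EFinP.
- by move=> w _; rewrite lee_fin.
Qed.

Lemma mom_measurable (f : T -> R) : mom f -> measurable_fun setT f.
Proof. by case=> mf _; exact: (mf tt). Qed.

Lemma measurable_normX (f : T -> R) k :
  measurable_fun setT f -> measurable_fun setT (fun w => `|f w| ^+ k).
Proof. by move=> mf; apply: measurable_funX; exact: measurableT_comp. Qed.

Lemma umom_reindex I J (f : I -> T -> R) (g : J -> I) :
  umom f -> umom (fun j => f (g j)).
Proof.
by case=> mf mo; split=> // k; have [K hK] := mo k; exists K => j; exact: hK.
Qed.

Lemma umom_mom I (f : I -> T -> R) i : umom f -> mom (f i).
Proof. exact: umom_reindex (fun _ : unit => i). Qed.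

Lemma umom_bounded I (f : I -> T -> R) (M : R) :
  (forall i, measurable_fun setT (f i)) -> (forall i w, `|f i w| <= M) -> umom f.
Proof.
move=> mf bf; split=> // k; exists (M ^+ k) => i.
apply: le_trans (_ : (\int[P]_w (cst (M ^+ k) w)%:E <= _)%E).
  apply: ge0_le_integral_EFin => //; first exact: measurable_normX.
  by move=> w; rewrite exprn_ge0//= lerXn2r// nnegrE ?(le_trans _ (bf i w)).
by rewrite -[leRHS]mule1 -(probability_setT P) -integral_cst.
Qed.

Lemma umom_cst I (c : R) : umom (fun (_ : I) (_ : T) => c).
Proof. by apply: (@umom_bounded _ _ `|c|). Qed.

(** The bound |f g|^k <= |f|^(2k) + |g|^(2k) spends moments of twice the order, which the bundling
    of all orders makes available. *)
Lemma umomM I (f g : I -> T -> R) :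
  umom f -> umom g -> umom (fun i w => f i w * g i w).
Proof.
move=> [mf f0] [mg g0]; split=> [i|k]; first exact: measurable_funM.
have [K hK] := f0 (k * 2)%N; have [L hL] := g0 (k * 2)%N; exists (K + L) => i.
have mp (h : I -> T -> R) : (forall i, measurable_fun setT (h i)) ->
    measurable_fun setT (fun w => `|h i w| ^+ (k * 2)).
  by move=> mh; exact: measurable_normX.
apply: le_trans (_ : (\int[P]_w (`|f i w| ^+ (k * 2) + `|g i w| ^+ (k * 2))%:E
    <= _)%E).
  apply: ge0_le_integral_EFin.
  - by apply: measurable_normX; exact: measurable_funM.
  - by apply: measurable_funD; exact: mp.
  move=> w; rewrite exprn_ge0//= normrM exprMn !exprM.
  have : 0 <= `|f i w| ^+ k by rewrite exprn_ge0.
  have : 0 <= `|g i w| ^+ k by rewrite exprn_ge0.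
  move: (_ ^+ k) (_ ^+ k) => x y x0 y0; nra.
rewrite ge0_integralD_EFin; last 4 first.
- exact: mp.
- exact: mp.
- by move=> w; rewrite exprn_ge0.
- by move=> w; rewrite exprn_ge0.
by rewrite EFinD leeD.
Qed.

Lemma umomD I (f g : I -> T -> R) :
  umom f -> umom g -> umom (fun i w => f i w + g i w).
Proof.
move=> [mf f0] [mg g0]; split=> [i|k]; first exact: measurable_funD.
have [K hK] := f0 k; have [L hL] := g0 k; exists (2 ^+ k * (K + L)) => i.
have mp (h : I -> T -> R) : (forall i, measurable_fun setT (h i)) ->
    measurable_fun setT (fun w => `|h i w| ^+ k).
  by move=> mh; exact: measurable_normX.
apply: le_trans (_ : (\int[P]_w (2 ^+ k * (`|f i w| ^+ k + `|g i w| ^+ k))%:E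
    <= _)%E).
  apply: ge0_le_integral_EFin.
  - by apply: measurable_normX; exact: measurable_funD.
  - by apply: measurable_funM => //; apply: measurable_funD; exact: mp.
  by move=> w; rewrite exprn_ge0//=; exact: normrD_pow_le.
rewrite ge0_integralZl_EFin; last 3 first.
- by apply: measurable_funD; exact: mp.
- by move=> w; rewrite addr_ge0// exprn_ge0.
- by rewrite exprn_ge0.
rewrite ge0_integralD_EFin; last 4 first.
- exact: mp.
- exact: mp.
- by move=> w; rewrite exprn_ge0.
- by move=> w; rewrite exprn_ge0.
by rewrite EFinM EFinD lee_wpmul2l// ?leeD// lee_fin exprn_ge0.
Qed.

Lemma umomN I (f : I -> T -> R) : umom f -> umom (fun i w => - f i w).
Proof.
move=> /(umomM (umom_cst I (-1))) [mf mo].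
rewrite (_ : (fun i w => _) = (fun i w => -1 * f i w)) //.
by apply/funext => i; apply/funext => w; rewrite mulN1r.
Qed.

Lemma umomX I (f : I -> T -> R) k : umom f -> umom (fun i w => f i w ^+ k).
Proof.
move=> mf; elim: k => [|k ih].
  by rewrite (_ : (fun i w => _) = (fun _ _ => 1))//; exact: umom_cst.
rewrite (_ : (fun i w => _) = (fun i w => f i w * f i w ^+ k)); last first.
  by apply/funext => i; apply/funext => w; rewrite exprS.
exact: umomM.
Qed.

Lemma umom_norm I (f : I -> T -> R) : umom f -> umom (fun i w => `|f i w|).
Proof.
move=> [mf mo]; split=> [i|k]; first exact: measurableT_comp.
have [K hK] := mo k; exists K => i.
by under eq_integral do rewrite normr_id; exact: hK.
Qed.

Lemma mom_cst (c : R) : mom (fun=> c). Proof. exact: umom_cst. Qed.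

Lemma momD (f g : T -> R) : mom f -> mom g -> mom (fun w => f w + g w).
Proof. exact: umomD. Qed.

Lemma momM (f g : T -> R) : mom f -> mom g -> mom (fun w => f w * g w).
Proof. exact: umomM. Qed.

Lemma momN (f : T -> R) : mom f -> mom (fun w => - f w).
Proof. exact: umomN. Qed.

Lemma momX (f : T -> R) k : mom f -> mom (fun w => f w ^+ k).
Proof. exact: umomX. Qed.

Lemma mom_norm (f : T -> R) : mom f -> mom (fun w => `|f w|).
Proof. exact: umom_norm. Qed.

Lemma mom_sum (J : Type) (r : seq J) (Q : pred J) (f : J -> T -> R) :
  (forall j, mom (f j)) -> mom (fun w => \sum_(j <- r | Q j) f j w).
Proof.
move=> mf; elim: r => [|j r ih].
  rewrite (_ : (fun w => _) = (fun=> 0)); first exact: mom_cst.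
  by apply/funext => w; rewrite big_nil.
rewrite (_ : (fun w => _) = fun w => (if Q j then f j w else 0) +
    \sum_(j <- r | Q j) f j w); last first.
  by apply/funext => w; rewrite big_cons; case: ifP => //; rewrite add0r.
by apply: momD => //; case: (Q j); [exact: mf|exact: mom_cst].
Qed.

Lemma mom_bounded (f : T -> R) (M : R) :
  measurable_fun setT f -> (forall w, `|f w| <= M) -> mom f.
Proof. by move=> mf bf; apply: (@umom_bounded _ _ M). Qed.

Lemma mom_integrable (f : T -> R) : mom f -> P.-integrable setT (EFin \o f).
Proof.
move=> mf; have := mom_measurable mf; case: mf => _ /(_ 1%N)[K /(_ tt) hK] mf.
apply/integrableP; split; first exact/measurable_EFinP.
by apply: le_lt_trans hK (ltry _).
Qed.

Definition Ex (f : T -> R) : R := \int[P]_w f w.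

Lemma expectation_Ex (f : T -> R) : mom f -> ('E_P[f] = (Ex f)%:E)%E.
Proof.
move=> mf; rewrite unlock /Ex /Rintegral fineK//.
exact: integrable_fin_num (mom_integrable mf).
Qed.

Lemma eq_Ex (f g : T -> R) : f =1 g -> Ex f = Ex g.
Proof. by move=> /funext ->. Qed.

Lemma Ex_cst (c : R) : Ex (fun=> c) = c.
Proof. by rewrite /Ex Rintegral_cst//= probability_setT mulr1. Qed.

Lemma ExD (f g : T -> R) : mom f -> mom g ->
  Ex (fun w => f w + g w) = Ex f + Ex g.
Proof. by move=> mf mg; apply: RintegralD => //; exact: mom_integrable. Qed.

Lemma ExZ (c : R) (f : T -> R) : mom f -> Ex (fun w => c * f w) = c * Ex f.
Proof. by move=> mf; apply: RintegralZl => //; exact: mom_integrable. Qed.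

Lemma ExN (f : T -> R) : mom f -> Ex (fun w => - f w) = - Ex f.
Proof.
move=> mf; rewrite -mulN1r -ExZ//; apply: eq_Ex => w; exact/esym/mulN1r.
Qed.

Lemma ExB (f g : T -> R) : mom f -> mom g ->
  Ex (fun w => f w - g w) = Ex f - Ex g.
Proof. by move=> mf mg; rewrite ExD ?ExN//; exact: momN. Qed.

Lemma Ex_le (f g : T -> R) : mom f -> mom g -> (forall w, f w <= g w) ->
  Ex f <= Ex g.
Proof.
by move=> mf mg fg; apply: le_Rintegral => //; exact: mom_integrable.
Qed.

Lemma Ex_ge0 (f : T -> R) : (forall w, 0 <= f w) -> 0 <= Ex f.
Proof. by move=> f0; exact: Rintegral_ge0. Qed.

Lemma Ex_norm (f : T -> R) : mom f -> `|Ex f| <= Ex (fun w => `|f w|).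
Proof.
by move=> mf; apply: le_normr_Rintegral => //; exact: mom_integrable.
Qed.

Lemma Ex_sum (J : Type) (r : seq J) (Q : pred J) (f : J -> T -> R) :
  (forall j, mom (f j)) ->
  Ex (fun w => \sum_(j <- r | Q j) f j w) = \sum_(j <- r | Q j) Ex (f j).
Proof.
move=> mf; elim: r => [|j r ih].
  by rewrite big_nil -[RHS](Ex_cst 0); apply: eq_Ex => w; rewrite big_nil.
rewrite big_cons -ih; case: ifP => Qj.
  rewrite -ExD//; last exact: mom_sum.
  by apply: eq_Ex => w; rewrite big_cons Qj.
by apply: eq_Ex => w; rewrite big_cons Qj.
Qed.

Lemma ae_eq_Ex (f g : T -> R) : measurable_fun setT f -> measurable_fun setT g ->
  {ae P, forall w, f w = g w} -> Ex f = Ex g.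
Proof.
move=> mf mg fg; congr fine; apply: ae_eq_integral => //.
- exact/measurable_EFinP.
- exact/measurable_EFinP.
- by apply: filterS fg => w /= ->.
Qed.

Lemma umom_Ex_bound I (f : I -> T -> R) : umom f ->
  exists2 K : R, 0 < K & forall i, Ex (f i) <= K.
Proof.
move=> mf; have [_ /(_ 1%N)[K hK]] := mf; exists (`|K| + 1) => [|i].
  by rewrite ltr_wpDl.
have mfi : mom (f i) by exact: umom_mom mf.
apply: le_trans (Ex_le mfi (mom_norm mfi) (fun w => ler_norm _)) _.
apply: le_trans (_ : K <= _); last by rewrite (le_trans (ler_norm K))// lerDl.
rewrite /Ex /Rintegral -lee_fin fineK; first exact: hK.
exact: integrable_fin_num (mom_integrable (mom_norm mfi)).
Qed.

End UniformMoments.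

Ltac mom_tac := lazymatch goal with
  | |- mom _ (fun w => @?f w + @?g w) => apply: (@momD _ _ _ _ f g); mom_tac
  | |- mom _ (fun w => @?f w * @?g w) => apply: (@momM _ _ _ _ f g); mom_tac
  | |- mom _ (fun w => - @?f w) => apply: (@momN _ _ _ _ f); mom_tac
  | |- mom _ (fun w => @?f w ^+ _) => apply: (@momX _ _ _ _ f); mom_tac
  | |- mom _ (fun w => `| @?f w |) => apply: (@mom_norm _ _ _ _ f); mom_tac
  | |- mom _ (fun _ => ?c) => exact: (mom_cst _ c)
  | H : mom _ ?f |- mom _ (fun w => ?f w) => exact: H
  | H : mom _ ?f |- mom _ ?f => exact: H
  | |- _ => first [assumption | by eauto]
  end.

(** * Moments of the normal distribution *)

Section NormalMoments.
Context {R : realType}.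
Local Notation mu := (@lebesgue_measure R).

(** The Radon-Nikodym derivative of the normal law and [normal_pdf] have the same integral over
    every measurable set, hence agree almost everywhere; the change of variables then transfers to
    the explicit density. *)
Lemma ge0_integral_normal_prob (s : R) (f : R -> R) :
  measurable_fun setT f -> (forall x, 0 <= f x) ->
  (\int[normal_prob 0 s]_x (f x)%:E
   = \int[mu]_x (f x * normal_pdf 0 s x)%:E)%E.
Proof.
move=> mf f0; have dom := normal_prob_dominates 0 s.
have mfE : measurable_fun setT (EFin \o f) by exact/measurable_EFinP.
have := Radon_Nikodym_SigmaFinite.change_of_variables dom
  (fun x => lee_tofin (f0 x)) (@measurableT _ R) mfE.
move=> <-.
apply: ae_eq_integral => //.
- apply: emeasurable_funM => //.
  exact: measurable_int (Radon_Nikodym_SigmaFinite.f_integrable dom).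
- apply/measurable_EFinP; apply: measurable_funM => //.
  exact: measurable_normal_pdf.
- under [X in ae_eq _ _ _ X]eq_fun do rewrite EFinM.
  apply: ae_eqe_mul2l; apply: integral_ae_eq => //.
  + exact: Radon_Nikodym_SigmaFinite.f_integrable.
  + by apply/measurable_EFinP; exact: measurable_normal_pdf.
  + by move=> E _ mE; rewrite -Radon_Nikodym_SigmaFinite.f_integral.
Qed.

(** Doubling the standard deviation leaves an exponential factor to absorb the power of x. Finite
    moments thus follow from the total mass of another normal density, without integration by
    parts. *)
Lemma normX_normal_pdf_le (s : R) (k : nat) : s != 0 ->
  exists2 K : R, 0 <= K &
    forall x, `|x| ^+ k * normal_pdf 0 s x <= K * normal_pdf 0 (2 * s) x.
Proof.
move=> s0; have s20 : 2 * s != 0 by rewrite mulf_neq0.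
have ss : 0 < s ^+ 2 by rewrite exprn_even_gt0.
pose L : R := 1 + (8 / 3 * s ^+ 2) ^+ k.+1 * k.+1`!%:R.
have L0 : 0 <= L.
  by rewrite /L addr_ge0// mulr_ge0// exprn_ge0// mulr_ge0// ltW.
exists (L * normal_peak s / normal_peak (2 * s)) => [|x].
  by rewrite !mulr_ge0 ?invr_ge0 ?normal_peak_ge0.
rewrite !normal_pdfE// [in leRHS]mulrA divfK; last first.
  by rewrite gt_eqF// normal_peak_gt0.
rewrite mulrCA -[leRHS]mulrA [leRHS]mulrCA ler_wpM2l ?normal_peak_ge0//.
rewrite /normal_fun !subr0.
(* [y] is the gap x^2/(2 s^2) - x^2/(8 s^2) between the two Gaussian exponents. Since 8/3 s^2 y =
   x^2, the constant [L] turns the Taylor term of order k+1 of exp y into x^(2(k+1)). *)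
pose y : R := 3 / 8 * x ^+ 2 / s ^+ 2.
have y0 : 0 <= y by rewrite /y divr_ge0 ?sqr_ge0// mulr_ge0 ?sqr_ge0// divr_ge0.
have -> : - x ^+ 2 / (s ^+ 2 *+ 2) = - y + - x ^+ 2 / ((2 * s) ^+ 2 *+ 2).
  by rewrite /y; field; rewrite s0.
rewrite expRD mulrA ler_wpM2r ?expR_ge0// expRN ler_pdivrMr ?expR_gt0//.
apply: le_trans (_ : L * (1 + y ^+ k.+1 / k.+1`!%:R) <= _); last first.
  by rewrite ler_wpM2l// expR_ge1Dxn.
have fk : (0 : R) < k.+1`!%:R by rewrite ltr0n fact_gt0.
have -> : L * (1 + y ^+ k.+1 / k.+1`!%:R) =
    1 + (8 / 3 * s ^+ 2) ^+ k.+1 * k.+1`!%:R + y ^+ k.+1 / k.+1`!%:R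
    + (8 / 3 * s ^+ 2) ^+ k.+1 * y ^+ k.+1.
  by rewrite /L; field; rewrite (gt_eqF fk).
rewrite -exprMn (_ : 8 / 3 * s ^+ 2 * y = x ^+ 2); last by rewrite /y; field; rewrite s0.
apply: le_trans (_ : 1 + (x ^+ 2) ^+ k.+1 <= _); last first.
  rewrite lerD2r -addrA lerDl addr_ge0//.
    by rewrite mulr_ge0 ?ltW// exprn_gt0// mulr_gt0// divr_gt0.
  by rewrite mulr_ge0 ?invr_ge0 ?exprn_ge0// ltW.
rewrite -[in leRHS](real_normK (num_real x)) -exprM.
have [x1|x1] := leP `|x| 1.
  rewrite (le_trans (exprn_ile1 _ (normr_ge0 _) x1))// lerDl exprn_ge0//.
apply: le_trans (_ : `|x| ^+ (2 * k.+1) <= _); last by rewrite lerDr.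
by apply: ler_weXn2l; rewrite ?(ltW x1)// mulnS mul2n -addnn addnA leq_addl.
Qed.

Lemma normal_prob_moments (s : R) (k : nat) : s != 0 ->
  exists K : R, (\int[normal_prob 0 s]_x (`|x| ^+ k)%:E <= K%:E)%E.
Proof.
move=> s0; have [K K0 hK] := normX_normal_pdf_le k s0; exists K.
have mX : measurable_fun setT (fun x : R => `|x| ^+ k).
  exact: measurable_funX.
rewrite ge0_integral_normal_prob//.
apply: le_trans (_ : \int[mu]_x (K * normal_pdf 0 (2 * s) x)%:E <= _)%E.
  apply: ge0_le_integral => //.
  - by move=> x _; rewrite lee_fin mulr_ge0// ?normal_pdf_ge0.
  - apply/measurable_EFinP; apply: measurable_funM => //.
    exact: measurable_normal_pdf.
  - apply/measurable_EFinP; apply: measurable_funM => //.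
    exact: measurable_normal_pdf.
  - by move=> x _; rewrite lee_fin.
under eq_integral do rewrite EFinM.
rewrite ge0_integralZl//.
- by rewrite integral_normal_pdf mule1.
- by apply/measurable_EFinP; exact: measurable_normal_pdf.
- by move=> x _; rewrite lee_fin ?normal_pdf_ge0.
Qed.

Lemma normal_prob_set1 (s x : R) : normal_prob 0 s [set x] = 0%E.
Proof.
have /null_content_dominatesP dom := normal_prob_dominates 0 s.
by apply: dom => //; exact: lebesgue_measure_set1.
Qed.

End NormalMoments.

(** * Moments of a contractive recursion *)

Section ContractiveForm.
Context {R : realType}.
Implicit Types (x y r s c : R).

(** The slack s - r absorbs all cross terms of the binomial: either c y <= (s - r) x and the base is
    at most s x, or x < c y / (s - r) and the base is at most D y. The rate s does not depend on k,
    so one contraction factor serves all moments. *)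
Lemma affine_pow_le r s c (k : nat) : 0 <= r -> r < s -> 0 <= c ->
  exists2 C : R, 0 <= C & forall x y, 0 <= x -> 0 <= y ->
    (r * x + c * y) ^+ k <= (s * x) ^+ k + C * y ^+ k.
Proof.
move=> r0 rs c0; have sr : 0 < s - r by rewrite subr_gt0.
pose D := r * (c / (s - r)) + c.
have D0 : 0 <= D by rewrite addr_ge0// mulr_ge0// divr_ge0// ltW.
exists (D ^+ k) => [|x y x0 y0]; first by rewrite exprn_ge0.
have [h|h] := leP (c * y) ((s - r) * x).
  apply: le_trans (_ : (s * x) ^+ k <= _); last first.
    by rewrite lerDl mulr_ge0 ?exprn_ge0.
  apply: lerXn2r; rewrite ?nnegrE; [|by rewrite mulr_ge0// (le_trans r0)// ltW|lra].
  by rewrite addr_ge0 ?mulr_ge0.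
apply: le_trans (_ : (D * y) ^+ k <= _); last first.
  by rewrite exprMn lerDr exprn_ge0// mulr_ge0// (le_trans r0)// ltW.
apply: lerXn2r; rewrite ?nnegrE ?addr_ge0 ?mulr_ge0//.
rewrite /D mulrDl lerD2r -mulrA ler_wpM2l// ltW//.
by rewrite mulrAC ltr_pdivlMr// mulrC.
Qed.

Lemma sqrD_le (eta x y : R) : 0 < eta ->
  (x + y) ^+ 2 <= (1 + eta) * x ^+ 2 + (1 + eta^-1) * y ^+ 2.
Proof.
move=> e0; rewrite -subr_ge0.
have -> : (1 + eta) * x ^+ 2 + (1 + eta^-1) * y ^+ 2 - (x + y) ^+ 2
    = eta^-1 * (eta * x - y) ^+ 2 by field; rewrite gt_eqF.
by rewrite mulr_ge0 ?sqr_ge0// invr_ge0 ltW.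
Qed.

(* Up to a scalar this is the inverse autocovariance form x^2 - 2 rho x y + y^2,
   which the noiseless AR(2) recursion does not increase. *)
Definition ar2_form (rho x y : R) : R := (1 - rho ^+ 2) * x ^+ 2 + (y - rho * x) ^+ 2.

Lemma ar2_form_ge0 (rho x y : R) : `|rho| < 1 -> 0 <= ar2_form rho x y.
Proof.
move=> h; rewrite addr_ge0 ?sqr_ge0// mulr_ge0 ?sqr_ge0// subr_ge0.
by rewrite -[rho ^+ 2]ger0_norm ?sqr_ge0// normrX exprn_ile1// ltW.
Qed.

(** One noiseless step lowers the form only by (1 - phi2^2) u^2, where u = y - rho x is the backward
    prediction error, and u may vanish. Two successive errors u, u1 determine (x, y), so two steps
    lower the form by a fixed fraction. *)
Lemma ar2_form_contract (rho phi2 : R) : `|rho| < 1 -> `|phi2| < 1 ->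
  exists r c, [/\ 0 <= r, r < 1, 0 <= c & forall x y e e' x1 x2,
    x1 = rho * x + phi2 * (y - rho * x) + e' ->
    x2 = rho * x1 + phi2 * (x - rho * x1) + e ->
    ar2_form rho x2 x1 <= r * ar2_form rho x y + c * (e ^+ 2 + e' ^+ 2)].
Proof.
move=> hr hp.
have rho2 : rho ^+ 2 < 1.
  by rewrite -[rho ^+ 2]ger0_norm ?sqr_ge0// normrX exprn_ilt1.
have phi22 : phi2 ^+ 2 < 1.
  by rewrite -[phi2 ^+ 2]ger0_norm ?sqr_ge0// normrX exprn_ilt1.
pose p := 1 - rho ^+ 2; have p0 : 0 < p by rewrite /p subr_gt0.
pose b := 1 - phi2 ^+ 2; have b0 : 0 < b by rewrite /b subr_gt0.
have p1 : p <= 1 by rewrite /p lerBlDr lerDl sqr_ge0.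
have b1 : b <= 1 by rewrite /b lerBlDr lerDl sqr_ge0.
(* [p / (2 + p)] is a coercivity constant: p times the form is (p x)^2 + p u^2, and p x = u1 + rho
   phi2 u, so it is at most (2 + p)(u^2 + u1^2). *)
pose r0 := 1 - b * (p / (2 + p)).
have p2 : 0 < 2 + p by lra.
have q0 : 0 < p / (2 + p) by rewrite divr_gt0.
have q1 : p / (2 + p) < 1 by rewrite ltr_pdivrMr//; lra.
have r00 : 0 <= r0 by rewrite /r0; nra.
have r01 : r0 < 1 by rewrite /r0; nra.
(* Half of the gap below 1: the factor 1 + eta paid in Young's inequality to split off the noise
   keeps (1 + eta) r0 below 1. *)
pose eta := (1 - r0) / 2.
have eta0 : 0 < eta by rewrite /eta divr_gt0// subr_gt0.
pose phi1 := rho * (1 - phi2).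
pose M := 6 * (1 + phi1 ^+ 2) + 2.
exists ((1 + eta) * r0), ((1 + eta^-1) * M); split.
- by rewrite mulr_ge0// addr_ge0// ltW.
- by rewrite /eta; nra.
- rewrite mulr_ge0// ?addr_ge0// ?invr_ge0 ?(ltW eta0)//.
  by rewrite mulr_ge0// addr_ge0// sqr_ge0.
move=> x y e e' x1 x2 x1E x2E.
pose u := y - rho * x.
pose y1 := rho * x + phi2 * u.
pose u1 := x - rho * y1.
pose y2 := rho * y1 + phi2 * u1.
pose d2 := phi1 * e' + e.
have E1 : x1 = y1 + e' by rewrite x1E.
have E2 : x2 = y2 + d2 by rewrite x2E /y2 /d2 /u1 E1 /phi1; ring.
have hom : ar2_form rho y2 y1 <= r0 * ar2_form rho x y.
  have W2 : ar2_form rho y2 y1 = ar2_form rho x y - b * (u ^+ 2 + u1 ^+ 2).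
    by rewrite /ar2_form /b /y2 /u1 /y1 /u; ring.
  have pos : p * ar2_form rho x y <= (2 + p) * (u ^+ 2 + u1 ^+ 2).
    have px : p * x = u1 + rho * phi2 * u by rewrite /p /u1 /y1 /u; ring.
    have : (p * x) ^+ 2 <= 2 * u1 ^+ 2 + 2 * u ^+ 2.
      have rp : (rho * phi2) ^+ 2 <= 1 by rewrite exprMn; nra.
      have := sqr_ge0 (u1 - rho * phi2 * u); have := sqr_ge0 u.
      rewrite px; nra.
    have -> : p * ar2_form rho x y = (p * x) ^+ 2 + p * u ^+ 2.
      by rewrite /ar2_form -/p -/u; ring.
    have := sqr_ge0 u1; have := sqr_ge0 u; nra.
  have key : p / (2 + p) * ar2_form rho x y <= u ^+ 2 + u1 ^+ 2.
    by rewrite mulrAC ler_pdivrMr// [leRHS]mulrC.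
  have -> : r0 * ar2_form rho x y
      = ar2_form rho x y - b * (p / (2 + p) * ar2_form rho x y).
    by rewrite /r0; ring.
  by rewrite W2 lerD2l lerN2 ler_wpM2l// ltW.
have noise : p * d2 ^+ 2 + (e' - rho * d2) ^+ 2 <= M * (e ^+ 2 + e' ^+ 2).
  have h1 : (e' - rho * d2) ^+ 2 <= 2 * e' ^+ 2 + 2 * d2 ^+ 2.
    have := sqr_ge0 (e' + rho * d2); have := sqr_ge0 d2; nra.
  have h2 : d2 ^+ 2 <= 2 * phi1 ^+ 2 * e' ^+ 2 + 2 * e ^+ 2.
    have := sqr_ge0 (phi1 * e' - e); rewrite /d2; nra.
  have := sqr_ge0 d2; have := sqr_ge0 e; have := sqr_ge0 e'.
  have := mulr_ge0 (sqr_ge0 phi1) (sqr_ge0 e); rewrite /M; nra.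
have split : ar2_form rho x2 x1 <= (1 + eta) * ar2_form rho y2 y1
    + (1 + eta^-1) * (p * d2 ^+ 2 + (e' - rho * d2) ^+ 2).
  rewrite /ar2_form -/p E1 E2.
  have -> : y1 + e' - rho * (y2 + d2) = (y1 - rho * y2) + (e' - rho * d2) by ring.
  have := sqrD_le (y1 - rho * y2) (e' - rho * d2) eta0.
  have := ler_wpM2l (ltW p0) (sqrD_le y2 d2 eta0).
  move: eta^-1 => etai; lra.
apply: (le_trans split); rewrite -mulrA lerD//.
  by rewrite ler_wpM2l// addr_ge0// ltW.
by rewrite -mulrA ler_wpM2l// addr_ge0// invr_ge0 ltW.
Qed.

End ContractiveForm.

Section ContractiveMoments.
Context {R : realType}.
Context {d : measure_display} {T : measurableType d}.
Variable P : probability T R.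

(** Monotone convergence: a bound uniform in the truncation level yields finiteness that is not
    known beforehand. *)
Lemma ge0_integral_trunc_le (f : T -> R) (K : R) :
  measurable_fun setT f -> (forall w, 0 <= f w) ->
  (forall N : nat, (\int[P]_w (Num.min (f w) N%:R)%:E <= K%:E)%E) ->
  (\int[P]_w (f w)%:E <= K%:E)%E.
Proof.
move=> mf f0 hK.
have mN N : measurable_fun setT (fun w => (Num.min (f w) N%:R)%:E).
  by apply/measurable_EFinP; apply: measurable_minr.
have N0 N w : setT w -> (0 <= (Num.min (f w) N%:R)%:E)%E.
  by move=> _; rewrite lee_fin le_min f0 ler0n.
have nd w : setT w -> {homo (fun N : nat => (Num.min (f w) N%:R)%:E) :
    n m / (n <= m)%N >-> (n <= m)%E}.
  move=> _ n m nm; rewrite lee_fin le_min ge_min lexx/=.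
  by rewrite ge_min ler_nat nm orbT.
have := cvg_monotone_convergence (@measurableT _ T) mN N0 nd (mu := P).
have -> : (fun w : T => limn (fun N : nat => (Num.min (f w) N%:R)%:E)) = EFin \o f.
  apply/funext => w /=; apply/cvg_lim => //; apply: cvg_near_cst.
  near=> N; congr EFin; apply/min_idPl.
  by near: N; exact: nbhs_infty_ger.
move=> h; rewrite -(cvg_lim _ h)//; apply: lime_le; first by apply/cvg_ex; eexists; exact: h.
exact: nearW.
Unshelve. all: by end_near.
Qed.

Lemma EFin_Ex (f : T -> R) : mom P f -> ((Ex P f)%:E = \int[P]_w (f w)%:E)%E.
Proof. by move=> mf; rewrite -expectation_Ex// unlock. Qed.

(** Truncated powers have finite expectation, so the recursion can be iterated on them. After m
    rounds the initial value carries the factor s^m, and at a fixed level N it is controlled by the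
    first moment alone; m tends to infinity before N does. The surviving bound does not depend on
    N. *)
Lemma umom_contraction (Y : int -> T -> R) (s Omega : R) :
  (forall t, measurable_fun setT (Y t)) -> (forall t w, 0 <= Y t w) ->
  0 <= s < 1 ->
  (forall t, (\int[P]_w (Y t w)%:E <= Omega%:E)%E) ->
  (forall k : nat, exists2 b : int -> T -> R, umom P b & forall t w,
     0 <= b t w /\ Y t w ^+ k.+1 <= (s * Y (t - 2) w) ^+ k.+1 + b t w) ->
  umom P Y.
Proof.
move=> mY Y0 /andP[s0 s1] YO hY; split=> // -[|k].
  exists 1 => t; under eq_integral do rewrite expr0.
  by rewrite -(EFin_Ex (mom_cst P 1)) Ex_cst.
have [b mb hb] := hY k; have [B B0 hB] := umom_Ex_bound mb.
set q := k.+1 in hb *.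
have sq1 : s ^+ q < 1 by rewrite exprn_ilt1.
(* The fixed point of G = B + s^q G, so that the accumulated noise terms never exceed it. *)
pose G := B / (1 - s ^+ q).
have G0 : 0 <= G by rewrite divr_ge0 ?(ltW B0)// subr_ge0 ltW.
have GE : B + s ^+ q * G = G.
  by rewrite /G; field; rewrite subr_eq0 gt_eqF.
exists G => t.
under eq_integral do rewrite (ger0_norm (Y0 t _)).
(* The scale [l] sits inside the minimum because truncation does not commute with scaling; each
   round replaces l by l s. *)
pose f (l : R) (N : nat) t w := Num.min ((l * Y t w) ^+ q) N%:R.
have mf l N t' : 0 <= l -> mom P (f l N t').
  move=> l0; apply: (@mom_bounded _ _ _ _ _ N%:R).
    apply: measurable_minr => //; apply: measurable_funX.
    exact: measurable_funM.
  move=> w; rewrite ger0_norm ?ge_min ?lexx ?orbT//.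
  by rewrite le_min ler0n andbT exprn_ge0// mulr_ge0.
have step N m : forall l t', 0 <= l ->
    Ex P (f l N t') <= Ex P (f (l * s ^+ m) N (t' - (2 * m)%:Z)) + l ^+ q * G.
  elim: m => [l t' l0|m ih l t' l0].
    by rewrite mulr1 muln0 subr0 lerDl mulr_ge0// exprn_ge0.
  have ls0 : 0 <= l * s by rewrite mulr_ge0.
  apply: le_trans (_ : Ex P (f (l * s) N (t' - 2)) + l ^+ q * B <= _); last first.
    rewrite -[in leRHS]GE mulrDr [_ + l ^+ q * (_ * _)]addrC addrA lerD2r.
    have := ih (l * s) (t' - 2) ls0.
    by rewrite exprMn -!mulrA -exprS -addrA -opprD -PoszD mulnS.
  apply: le_trans (_ : Ex P (fun w => f (l * s) N (t' - 2) w + l ^+ q * b t' w)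
      <= _); last first.
    have mbt : mom P (b t') by exact: umom_mom mb.
    rewrite ExD; [|exact: mf|by mom_tac].
    by rewrite ExZ// lerD2l ler_wpM2l// exprn_ge0.
  apply: Ex_le; [exact: mf| |].
    have mbt : mom P (b t') by exact: umom_mom mb.
    by apply: momD; [exact: mf|mom_tac].
  move=> w; have [bw Yw] := hb t' w; rewrite /f.
  have lY : (l * Y t' w) ^+ q <= (l * s * Y (t' - 2) w) ^+ q + l ^+ q * b t' w.
    rewrite -[l * s * _]mulrA (exprMn _ l (Y t' w)) (exprMn _ l (s * _)).
    by rewrite -mulrDr ler_wpM2l// exprn_ge0.
  have lb0 : 0 <= l ^+ q * b t' w by rewrite mulr_ge0// exprn_ge0.
  have [h2|h2] := leP ((l * s * Y (t' - 2) w) ^+ q) N%:R.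
    by rewrite ge_min lY.
  by rewrite ge_min lerDl lb0 orbT.
apply: ge0_integral_trunc_le.
- exact: measurable_funX.
- by move=> w; rewrite exprn_ge0.
move=> N.
have -> : (\int[P]_w (Num.min (Y t w ^+ q) N%:R)%:E = (Ex P (f 1 N t))%:E)%E.
  rewrite (EFin_Ex (mf _ _ _ ler01)); apply: eq_integral => w _.
  by rewrite /f mul1r.
rewrite lee_fin.
(* With v = s^m Y, min(v^q, N) <= (1 + N) v: if v <= 1 then v^q <= v, otherwise N <= N v. Only the
   first moment bound [Omega] enters. *)
have small m : Ex P (f 1 N t) <= (1 + N%:R) * s ^+ m * Omega + G.
  apply: (le_trans (step N m 1 t ler01)); rewrite expr1n !mul1r lerD2r.
  have sm0 : 0 <= s ^+ m by rewrite exprn_ge0.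
  have c0 : 0 <= (1 + N%:R) * s ^+ m by rewrite mulr_ge0// addr_ge0.
  rewrite -lee_fin (EFin_Ex (mf _ _ _ sm0)).
  apply: le_trans (_ : \int[P]_w ((1 + N%:R) * s ^+ m * Y (t - (2 * m)%:Z) w)%:E
      <= _)%E.
    apply: ge0_le_integral_EFin.
    - exact: mom_measurable (mf _ _ _ sm0).
    - exact: measurable_funM.
    move=> w; rewrite le_min ler0n exprn_ge0 ?mulr_ge0//=.
    rewrite -[leRHS]mulrA; set v := _ * Y _ w.
    have v0 : 0 <= v by rewrite mulr_ge0.
    have [v1|v1] := leP v 1.
      rewrite ge_min; apply/orP; left; rewrite /q exprS mulrC.
      apply: ler_wpM2r => //; apply: (le_trans (exprn_ile1 _ v0 v1)).
      by rewrite lerDl.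
    rewrite ge_min; apply/orP; right.
    apply: le_trans (_ : (1 + N%:R) * 1 <= _); first by rewrite mulr1 lerDr.
    by rewrite ler_wpM2l ?(ltW v1)// addr_ge0.
  by rewrite ge0_integralZl_EFin// (EFinM (_ * _) Omega) lee_wpmul2l// lee_fin.
apply/ler_addgt0Pr => eps eps0.
have Om0 : 0 <= Omega.
  by rewrite -lee_fin (le_trans _ (YO t))// integral_ge0// => w _; rewrite lee_fin.
have : (GRing.exp s : R^nat) @ \oo --> (0 : R).
  by apply: cvg_expr; rewrite ger0_norm.
have c1 : 0 < (1 + N%:R) * (1 + Omega).
  by rewrite mulr_gt0// ltr_wpDr.
move=> /cvgr0_norm_lt /(_ (eps / ((1 + N%:R) * (1 + Omega)))).
case=> [|m _ /(_ m (leqnn m)) /=]; first by rewrite divr_gt0.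
rewrite ger0_norm ?exprn_ge0// ltr_pdivlMr// => sm.
rewrite (le_trans (small m))// addrC lerD2l (le_trans _ (ltW sm))//.
rewrite mulrAC mulrC ler_wpM2l ?exprn_ge0// ler_wpM2l ?addr_ge0//.
by rewrite lerDr.
Qed.

End ContractiveMoments.

(** * Independence of the past *)

Section Independence.
Context {d : measure_display} {T : measurableType d} {R : realType}.
Variable P : probability T R.

(** The product rule on rectangles identifies the joint law with the product of the marginals;
    Fubini then factors the integral of x y. *)
Lemma Ex_mul_indep_RV (X Y : {RV P >-> R}) : mom P X -> mom P Y ->
  (forall A B, measurable A -> measurable B ->
    P (X @^-1` A `&` Y @^-1` B) = (P (X @^-1` A) * P (Y @^-1` B))%E) ->
  Ex P (fun w => X w * Y w) = Ex P X * Ex P Y.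
Proof.
move=> mX mY ind.
have mZ : measurable_fun setT (fun w => (X w, Y w)) by exact: measurable_fun_pair.
pose Z : {RV P >-> (R * R)%type} := mfun_Sub (mem_set mZ).
pose muX := distribution P X; pose muY := distribution P Y.
have eqI (f : R * R -> \bar R) :
    (\int[muX \x muY]_z f z = \int[distribution P Z]_z f z)%E.
  apply: eq_measure_integral => A mA _.
  by apply: product_measure_unique => // B C mB mC; rewrite -ind.
pose f (z : R * R) : \bar R := (z.1 * z.2)%:E.
have mf : measurable_fun setT f.
  apply/measurable_EFinP; apply: measurable_funM.
  - exact: measurable_fst.
  - exact: measurable_snd.
have mXY : mom P (fun w => X w * Y w) by exact: momM.
have intXY := mom_integrable mXY.
have intf : (muX \x muY)%E.-integrable setT f.
  apply/integrableP; split => //; rewrite eqI.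
  rewrite ge0_integral_distribution//; last exact: measurableT_comp.
  by case/integrableP: intXY.
have intId (V : {RV P >-> R}) : mom P V ->
    (distribution P V).-integrable setT (EFin \o id).
  move=> mV; apply: integrable_pushforward => //.
  - exact/measurable_EFinP.
  - exact: mom_integrable mV.
have IV (V : {RV P >-> R}) : mom P V ->
    (\int[distribution P V]_x x%:E = (Ex P V)%:E)%E.
  move=> mV; rewrite integral_distribution//; last exact: mom_integrable.
  by rewrite EFin_Ex.
apply: EFin_inj; rewrite (EFin_Ex mXY).
transitivity (\int[distribution P Z]_z f z)%E.
  by rewrite integral_distribution.
rewrite -eqI -(integral12_prod_meas1 intf) /fubini_F /f /=.
under eq_integral => x _.
  under eq_integral do rewrite EFinM.
  rewrite integralZl//; last exact: intId.
  rewrite IV//.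
  over.
by rewrite /= integralZr//; [rewrite IV// EFinM|exact: intId].
Qed.

Lemma Ex_mul_indep (X Y : T -> R) : mom P X -> mom P Y ->
  (forall A B, measurable A -> measurable B ->
    P (X @^-1` A `&` Y @^-1` B) = (P (X @^-1` A) * P (Y @^-1` B))%E) ->
  Ex P (fun w => X w * Y w) = Ex P X * Ex P Y.
Proof.
move=> mX mY.
exact: (@Ex_mul_indep_RV (mfun_Sub (mem_set (mom_measurable mX)))
                         (mfun_Sub (mem_set (mom_measurable mY)))).
Qed.

End Independence.

Section Past.
Context {d : measure_display} {T : measurableType d} {R : realType}.
Variable P : probability T R.
Variable z : int -> {RV P >-> R}.

(** Measurability with respect to the past, phrased by preimages in the form that
    [independent_of_past] consumes; [pastP] recasts it as a measurable function, whence the closure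
    properties. *)
Definition past (t : int) (X : T -> R) : Prop :=
  forall B, measurable B -> sigma_past z t (X @^-1` B).

Let gens (t : int) : set (set T) := \bigcup_(s in [set s : int | s < t])
        preimage_set_system setT (z s) measurable.

Let pastP (t : int) (X : T -> R) :
  past t X <-> measurable_fun [set: g_sigma_algebraType (gens t)] X.
Proof.
split=> [h _ B mB|h B mB]; first by rewrite setTI; exact: h.
by have := h (@measurableT _ (g_sigma_algebraType (gens t))) B mB; rewrite setTI.
Qed.

Lemma past_process (s t : int) : s < t -> past t (z s).
Proof.
move=> st B mB; apply: sub_sigma_algebra; exists s => //.
by exists B => //; rewrite setTI.
Qed.

Lemma past_le (s t : int) X : s <= t -> past s X -> past t X.
Proof.
move=> st h B mB; apply: sub_sigma_algebra2 (h B mB).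
by move=> A [u /= us hA]; exists u => //=; exact: lt_le_trans st.
Qed.

Lemma past_cst (t : int) (c : R) : past t (fun=> c).
Proof. by apply/pastP; exact: measurable_cst. Qed.

Lemma pastD (t : int) X Y : past t X -> past t Y -> past t (fun w => X w + Y w).
Proof. by move=> /pastP hX /pastP hY; apply/pastP; exact: measurable_funD. Qed.

Lemma pastM (t : int) X Y : past t X -> past t Y -> past t (fun w => X w * Y w).
Proof. by move=> /pastP hX /pastP hY; apply/pastP; exact: measurable_funM. Qed.

Lemma pastN (t : int) X : past t X -> past t (fun w => - X w).
Proof. by move=> /pastP hX; apply/pastP; exact: measurableT_comp. Qed.

Lemma pastX (t : int) X k : past t X -> past t (fun w => X w ^+ k).
Proof. by move=> /pastP hX; apply/pastP; exact: measurable_funX. Qed.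

End Past.

(** * The AR(2) model *)

(** The ratio is the lag-one autocorrelation, and the two slanted sides of the stationarity triangle
    bound it from either side. *)
Lemma normr_reflection_lt1 (R : realFieldType) (phi1 phi2 : R) :
  `|phi2| < 1 -> phi1 + phi2 < 1 -> phi2 - phi1 < 1 ->
  `|phi1 / (1 - phi2)| < 1.
Proof.
rewrite ltr_norml => /andP[_ h] hsum hdiff.
have h0 : 0 < 1 - phi2 by lra.
rewrite normrM normfV (gtr0_norm h0) ltr_pdivrMr// mul1r ltr_norml.
by apply/andP; split; lra.
Qed.

Section UmomComparison.
Context {d : measure_display} {T : measurableType d} {R : realType}.
Variable P : probability T R.

Lemma umom_le (I : Type) (f g : I -> T -> R) :
  (forall i, measurable_fun setT (f i)) ->
  (forall i w, `|f i w| <= `|g i w|) -> umom P g -> umom P f.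
Proof.
move=> mf fg [mg hg]; split=> // k; have [K hK] := hg k; exists K => i.
apply: le_trans (hK i); apply: ge0_le_integral_EFin.
- exact: measurable_normX.
- exact: measurable_normX.
- by move=> w; rewrite exprn_ge0//= lerXn2r// nnegrE.
Qed.

Lemma umom_ae_eq (I : Type) (f g : I -> T -> R) :
  (forall i, measurable_fun setT (f i)) ->
  (forall i, {ae P, forall w, f i w = g i w}) -> umom P g -> umom P f.
Proof.
move=> mf fg [mg hg]; split=> // k; have [K hK] := hg k; exists K => i.
rewrite (_ : (\int[P]_w (`|f i w| ^+ k)%:E = \int[P]_w (`|g i w| ^+ k)%:E)%E)//.
apply: ge0_ae_eq_integral => //.
- by apply/measurable_EFinP; exact: measurable_normX.
- by apply/measurable_EFinP; exact: measurable_normX.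
- by have := fg i; apply: filterS => w /= ->.
Qed.

End UmomComparison.

Section Model.
Context {d : measure_display} {T : measurableType d} {R : realType}.
Variable P : probability T R.

(** [mu k] is the k-th noise moment and [g0], [g1], [g2] are the autocovariances. The innovation [e]
    is defined pointwise from z, since it must be measurable with respect to the past of z, while
    the noise [a] equals it only almost surely. *)
Record ar2_model (phi1 phi2 : R) (mu : nat -> R) (g0 g1 g2 : R) (z : int -> {RV P >-> R})
    (e : int -> T -> R) : Prop := AR2Model {
  ar2_umom : umom P (fun t : int => z t : T -> R) ;
  ar2_innovE : forall t w, e t w = z t w - phi1 * z (t - 1) w - phi2 * z (t - 2) w ;
  ar2_cov0 : forall t, Ex P (fun w => z t w * z t w) = g0 ;
  ar2_cov1 : forall t, Ex P (fun w => z t w * z (t - 1) w) = g1 ;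
  ar2_cov2 : forall t, Ex P (fun w => z t w * z (t - 2) w) = g2 ;
  ar2_mean : forall t, Ex P (z t) = 0 ;
  ar2_innov_moment : forall k t X, past z t X -> mom P X ->
    Ex P (fun w => X w * e t w ^+ k) = mu k * Ex P X ;
  ar2_innov_mean : mu 1 = 0 ;
  ar2_innov_var : 0 < mu 2 }.

End Model.

(** * Moments and factorisation for the causal Gaussian process *)

Section CausalAR2.
Context (R : realType) (d : measure_display) (T : measurableType d)
  (P : probability T R) (phi1 phi2 sigma : R) (z a : int -> {RV P >-> R}).
Hypotheses (hphi2 : `|phi2| < 1) (hsum : phi1 + phi2 < 1)
  (hdiff : phi2 - phi1 < 1) (hsigma : 0 < sigma ^+ 2)
  (hz : causal_stationary_AR2 phi1 phi2 sigma z a).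

Let e (t : int) (w : T) : R := z t w - phi1 * z (t - 1) w - phi2 * z (t - 2) w.

Let mz t : measurable_fun setT (z t). Proof. exact: measurable_funPT. Qed.

Let me t : measurable_fun setT (e t).
Proof.
apply: measurable_funB; first apply: measurable_funB => //.
- exact: measurable_funM.
- exact: measurable_funM.
Qed.

Let sigma0 : sigma != 0.
Proof. by apply/eqP => s0; move: hsigma; rewrite s0 expr0n/= ltxx. Qed.

Let ae_e t : {ae P, forall w, e t w = a t w}.
Proof.
have := AR2_recursion hz t; apply: filterS => w /= h.
by rewrite /e h; ring.
Qed.

Let ge0_integral_noise t (f : R -> R) : measurable_fun setT f ->
  (forall x, 0 <= f x) ->
  (\int[P]_w (f (a t w))%:E = \int[normal_prob 0 sigma]_x (f x)%:E)%E.
Proof.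
move=> mf f0.
have ma : measurable_fun [set: T] (a t : T -> measurableTypeR R).
  exact: measurable_funPT (a t).
have mfE : measurable_fun [set: measurableTypeR R] (fun x => (f x)%:E).
  exact/measurable_EFinP.
have := ge0_integral_pushforward ma P (@measurableT _ (measurableTypeR R)) mfE.
rewrite preimage_setT => <-; last by move=> x _; rewrite lee_fin.
apply: eq_measure_integral => A mA _; exact: (AR2_noise_normal hz t mA).
Qed.

Let umom_a : umom P (fun t : int => a t : T -> R).
Proof.
split=> [t|k]; first exact: measurable_funPT.
have [K hK] := normal_prob_moments k sigma0; exists K => t.
rewrite (@ge0_integral_noise t (fun x => `|x| ^+ k))//.
exact: measurable_funX.
Qed.

Let umom_e : umom P e.
Proof. exact: umom_ae_eq umom_a. Qed.

Let mu (k : nat) : R := Ex P (fun w => a 0 w ^+ k).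

Let mom_a t : mom P (a t). Proof. exact: umom_mom umom_a. Qed.

(** The change to the normal law is available for nonnegative integrands, so the signed power is
    recovered as the difference of x^k + |x|^k and |x|^k. *)
Let moment_a k t : Ex P (fun w => a t w ^+ k) = mu k.
Proof.
have absE t' : Ex P (fun w => `|a t' w| ^+ k) = Ex P (fun w => `|a 0 w| ^+ k).
  have mX t'' : mom P (fun w => `|a t'' w| ^+ k) by mom_tac.
  apply: EFin_inj; rewrite !EFin_Ex//.
  rewrite !(@ge0_integral_noise _ (fun x => `|x| ^+ k))//.
  - exact: measurable_funX.
  - exact: measurable_funX.
have posE t' : Ex P (fun w => a t' w ^+ k + `|a t' w| ^+ k)
    = Ex P (fun w => a 0 w ^+ k + `|a 0 w| ^+ k).
  have mX t'' : mom P (fun w => a t'' w ^+ k + `|a t'' w| ^+ k) by mom_tac.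
  apply: EFin_inj; rewrite !EFin_Ex//.
  have f0 (x : R) : 0 <= x ^+ k + `|x| ^+ k.
    by rewrite -normrX -lerBlDr sub0r lerNnormlW.
  rewrite !(@ge0_integral_noise _ (fun x => x ^+ k + `|x| ^+ k))//.
  - by apply: measurable_funD; exact: measurable_funX.
  - by apply: measurable_funD; exact: measurable_funX.
by have := posE t; rewrite !ExD ?absE; [move=> /addIr ->|mom_tac..].
Qed.

(** Zero variance would concentrate the normal law on the point 0, which it does not charge. *)
Let var_gt0 : 0 < mu 2.
Proof.
rewrite lt_neqAle Ex_ge0 ?andbT => [|w]; last by rewrite sqr_ge0.
apply/eqP => /esym v0.
have : (\int[normal_prob 0 sigma]_x `|(x ^+ 2)%:E| = 0)%E.
  under eq_integral do rewrite gee0_abs ?lee_fin ?sqr_ge0//.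
  rewrite -(@ge0_integral_noise 0 (fun x => x ^+ 2))//; last first.
    by move=> x; rewrite sqr_ge0.
  by rewrite -(EFin_Ex (momX 2 (mom_a 0))) -/(mu 2) v0.
move=> /ae_eq_integral_abs => /(_ (@measurableT _ _)).
case=> [|N [mN N0 hN]]; first by apply/measurable_EFinP; exact: measurable_funX.
have : (normal_prob 0 sigma [set: R] <= 0)%E.
  rewrite -(adde0 0%E) -[X in (X + _)%E]N0 -[X in (_ + X)%E](normal_prob_set1 sigma 0).
  apply: le_trans (measureU2 (normal_prob 0 sigma) mN _) => //.
  apply: le_measure; rewrite ?inE//; first exact: measurableU.
  move=> x _; have [->|x0] := eqVneq x 0; first by right.
  by left; apply: hN => /= /(_ Logic.I) [] /eqP; rewrite sqrf_eq0 (negbTE x0).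
by rewrite probability_setT lee_fin ler10.
Qed.

Let cov_E (s t : int) :
  covariance P (z s) (z t) = (\int[P]_w (z s w * z t w)%:E)%E.
Proof.
rewrite unlock !(AR2_mean0 hz)/= unlock.
by apply: eq_integral => w _ /=; rewrite !fctE/= !subr0.
Qed.

Let cov_shift (s t h : int) :
  (\int[P]_w (z (s + h) w * z (t + h) w)%:E = \int[P]_w (z s w * z t w)%:E)%E.
Proof. by rewrite -!cov_E; case: (AR2_stationary hz) => _ _; exact. Qed.

Let rho := phi1 / (1 - phi2).

Let normr_rho_lt1 : `|rho| < 1. Proof. exact: normr_reflection_lt1. Qed.

Let form_ge0 t w : 0 <= ar2_form rho (z t w) (z (t - 1) w).
Proof. exact: ar2_form_ge0 normr_rho_lt1. Qed.

Let m_form t : measurable_fun setT (fun w => ar2_form rho (z t w) (z (t - 1) w)).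
Proof.
apply: measurable_funD.
  by apply: measurable_funM => //; exact: measurable_funX.
apply: measurable_funX; apply: measurable_funB => //.
exact: measurable_funM.
Qed.

Let sq_bound : exists K : R, forall t, (\int[P]_w (z t w ^+ 2)%:E <= K%:E)%E.
Proof.
have [/(_ 0) L2 _ _] := AR2_stationary hz.
have fin := integrable_fin_num (@measurableT _ T) (Lfun2_integrable_sqr L2).
exists (fine (\int[P]_w (z 0 w ^+ 2)%:E)%E) => t.
rewrite fineK//.
have := cov_shift 0 0 t; rewrite add0r => h.
by rewrite (eq_integral _ _ (fun w _ => congr1 EFin (expr2 (z t w)))) h.
Qed.

Let rho2_le1 : rho ^+ 2 <= 1.
Proof.
by rewrite -[rho ^+ 2]ger0_norm ?sqr_ge0// normrX exprn_ile1// ltW// normr_rho_lt1.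
Qed.

Let umom_form : umom P (fun (t : int) w => ar2_form rho (z t w) (z (t - 1) w)).
Proof.
have [r [c [r0 r1 c0 hrc]]] := ar2_form_contract normr_rho_lt1 hphi2.
have [K hK] := sq_bound.
(* Any rate strictly between r and 1 works, but it must be fixed before k. The first moment bound 5
   K below comes from the form being at most 3 x^2 + 2 y^2. *)
pose s := (1 + r) / 2.
have rs : r < s by rewrite /s; lra.
apply: (@umom_contraction _ _ _ _ _ s (5 * K)) => //.
- by rewrite /s; apply/andP; split; lra.
- move=> t.
  apply: le_trans (_ : \int[P]_w (3 * z t w ^+ 2 + 2 * z (t - 1) w ^+ 2)%:E <= _)%E.
    apply: ge0_le_integral_EFin => //.
      by apply: measurable_funD; apply: measurable_funM => //; exact: measurable_funX.
    move=> w; rewrite form_ge0 /ar2_form/=.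
    have := sqr_ge0 (z (t - 1) w + rho * z t w).
    have := mulr_ge0 (sqr_ge0 rho) (sqr_ge0 (z t w)).
    have := ler_wpM2r (sqr_ge0 (z t w)) rho2_le1.
    move: (z t w) (z (t - 1) w) => x y; nra.
  rewrite ge0_integralD_EFin; last 4 first.
  - by apply: measurable_funM => //; exact: measurable_funX.
  - by apply: measurable_funM => //; exact: measurable_funX.
  - by move=> w; rewrite mulr_ge0// sqr_ge0.
  - by move=> w; rewrite mulr_ge0// sqr_ge0.
  have -> : 5 * K = 3 * K + 2 * K by ring.
  rewrite EFinD; apply: leeD.
    rewrite ge0_integralZl_EFin//.
    - by rewrite EFinM lee_wpmul2l// lee_fin.
    - exact: measurable_funX.
    - by move=> w; rewrite sqr_ge0.
  rewrite ge0_integralZl_EFin//.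
  - by rewrite EFinM lee_wpmul2l// lee_fin.
  - exact: measurable_funX.
  - by move=> w; rewrite sqr_ge0.
- move=> k; have [C C0 hC] := affine_pow_le k.+1 r0 rs c0.
  exists (fun t w => C * (e t w ^+ 2 + e (t - 1) w ^+ 2) ^+ k.+1).
    apply: umomM; first exact: umom_cst.
    apply: umomX; apply: umomD; apply: umomX => //.
    exact: (umom_reindex (fun t : int => t - 1) umom_e).
  move=> t w; have b0 : 0 <= e t w ^+ 2 + e (t - 1) w ^+ 2.
    by rewrite addr_ge0// sqr_ge0.
  split; first by rewrite mulr_ge0// exprn_ge0.
  apply: le_trans (hC _ _ (form_ge0 (t - 2) w) b0).
  apply: lerXn2r; rewrite ?nnegrE//.
    by rewrite addr_ge0 ?mulr_ge0.
  have phi2_neq1 : 1 - phi2 != 0.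
    by rewrite gt_eqF// subr_gt0 (le_lt_trans (ler_norm _)).
  have phi1E : phi1 = rho * (1 - phi2) by rewrite /rho divfK.
  apply: hrc.
  - rewrite /e -!addrA -!opprD phi1E; have -> : (1 + 1 : int) = 2 by [].
    have -> : (1 + 2 : int) = 2 + 1 by [].
    by ring.
  - by rewrite /e phi1E; ring.
Qed.

Let umom_z : umom P (fun t : int => z t : T -> R).
Proof.
have p0 : 0 < 1 - rho ^+ 2.
  rewrite subr_gt0 -[rho ^+ 2]ger0_norm ?sqr_ge0// normrX.
  by rewrite exprn_ilt1// normr_rho_lt1.
apply: (@umom_le _ _ _ _ _ _
  (fun t w => 1 + (1 - rho ^+ 2)^-1 * ar2_form rho (z t w) (z (t - 1) w))).
- by move=> t; exact: mz.
- move=> t w; set Y := _^-1 * _.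
  have zY : z t w ^+ 2 <= Y.
    rewrite /Y ler_pdivlMl// /ar2_form lerDl sqr_ge0//.
  have Y0 : 0 <= Y by exact: le_trans (sqr_ge0 _) zY.
  rewrite (ger0_norm (addr_ge0 ler01 Y0)) (le_trans _ (lerD (lexx 1) zY))//.
  rewrite -[z t w ^+ 2](real_normK (num_real _)).
  have := sqr_ge0 (`|z t w| - 1); have := normr_ge0 (z t w); nra.
- apply: umomD; first exact: umom_cst.
  by apply: umomM => //; exact: umom_cst.
Qed.

Let mom_z t : mom P (z t). Proof. exact: umom_mom umom_z. Qed.

Let mean_z t : Ex P (z t) = 0.
Proof.
by apply: EFin_inj; rewrite -expectation_Ex// (AR2_mean0 hz).
Qed.

(** Read off from the zero mean of z through the recursion, which spares an integral against the
    normal density. *)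
Let mean_a t : Ex P (a t) = 0.
Proof.
rewrite -(ae_eq_Ex _ _ (ae_e t))//.
have m1 : mom P (fun w => phi1 * z (t - 1) w) by mom_tac.
have m2 : mom P (fun w => phi2 * z (t - 2) w) by mom_tac.
rewrite /e ExB//; last by mom_tac.
by rewrite ExB// !ExZ// !mean_z !mulr0 !subr0.
Qed.

Let indep_noise t X (A B : set R) : past z t X -> measurable A -> measurable B ->
  P (X @^-1` A `&` a t @^-1` B) = (P (X @^-1` A) * P (a t @^-1` B))%E.
Proof. by move=> hX mA mB; apply: (AR2_causal hz) => //; exact: hX. Qed.

Lemma causal_AR2_model : exists mu g0 g1 g2, ar2_model phi1 phi2 mu g0 g1 g2 z e.
Proof.
have cov (k t : int) :
    Ex P (fun w => z t w * z (t - k) w) = Ex P (fun w => z 0 w * z (- k) w).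
  congr fine; have := cov_shift 0 (- k) t.
  by rewrite add0r addrC.
exists mu, (Ex P (fun w => z 0 w * z 0 w)), (Ex P (fun w => z 0 w * z (- 1) w)),
  (Ex P (fun w => z 0 w * z (- 2) w)); split => //.
- by move=> t; have := cov 0 t; rewrite subr0 oppr0.
- move=> k t X pX mX.
  (* Causality concerns [a t]; [e t] is replaced by it up to a null set before the expectation
     factors. *)
  transitivity (Ex P (fun w => X w * a t w ^+ k)).
    have mX' := mom_measurable mX.
    apply: ae_eq_Ex.
    - by apply: measurable_funM => //; exact: measurable_funX.
    - by apply: measurable_funM => //; exact: measurable_funX.
    - by have := ae_e t; apply: filterS => w /= ->.
  rewrite (@Ex_mul_indep _ _ _ _ _ (fun w => a t w ^+ k))//; [|exact: momX|].
    by rewrite moment_a mulrC.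
  move=> A B mA mB.
  have mB' : measurable ((fun x : R => x ^+ k) @^-1` B).
    rewrite -[X in measurable X]setTI.
    by apply: (@measurable_funX _ _ _ setT id k _ measurableT).
  exact: (indep_noise pX mA mB').
- rewrite /mu -(mean_a 0); apply: eq_Ex => w; exact: expr1.
Qed.

End CausalAR2.

(** * Sums of martingale differences *)

Section MartingaleSums.
Context {d : measure_display} {T : measurableType d} {R : realType}.
Variables (P : probability T R) (z : int -> {RV P >-> R}).
Implicit Types X Y : int -> T -> R.

(** Martingale differences without conditional expectations: orthogonality is tested against every
    past variable with all moments. Index t + 1 in [mds_past] means measurable with respect to z up
    to and including time t. *)
Record mds X : Prop := Mds {
  mds_umom : umom P X ;
  mds_past : forall t, past z (t + 1) (X t) ;
  mds_orth : forall t W, past z t W -> mom P W -> Ex P (fun w => W w * X t w) = 0 }.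

(** The window 3..n is that of C, E, G, H: n - 2 terms, the first of which reaches back to z_1. The
    sum is empty for n = 2, which anchors the inductions. *)
Definition psum X (n : nat) (w : T) : R := \sum_(3 <= t < n.+1) X t%:Z w.

Lemma psumS X n w : (2 <= n)%N -> psum X n.+1 w = psum X n w + X n.+1%:Z w.
Proof. by move=> n2; rewrite /psum big_nat_recr. Qed.

Lemma psum_small X n w : (n < 3)%N -> psum X n w = 0.
Proof. by move=> n3; rewrite /psum big_geq. Qed.

Lemma mom_psum X n : umom P X -> mom P (psum X n).
Proof. by move=> mX; apply: mom_sum => t; exact: umom_mom mX. Qed.

Lemma past_psum X n : mds X -> past z n.+1%:Z (psum X n).
Proof.
move=> hX; elim: n => [|n ih].
  rewrite (_ : psum X 0 = fun=> 0); first exact: past_cst.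
  by apply/funext => w; rewrite psum_small.
have [n2|n2] := leqP 2 n.
  rewrite (_ : psum X n.+1 = fun w => psum X n w + X n.+1%:Z w); last first.
    by apply/funext => w; rewrite psumS.
  apply: pastD; first by apply: (past_le _ ih); rewrite lez_nat.
  by have := @mds_past X hX n.+1%:Z; rewrite -PoszD addn1.
rewrite (_ : psum X n.+1 = fun=> 0); first exact: past_cst.
by apply/funext => w; rewrite psum_small.
Qed.

Lemma Ex_psumM X Y (k : R) : mds X -> mds Y ->
  (forall t, Ex P (fun w => X t w * Y t w) = k) ->
  forall n, (2 <= n)%N ->
    Ex P (fun w => psum X n w * psum Y n w) = (n%:R - 2) * k.
Proof.
move=> hX hY hk; have mX t := umom_mom t (mds_umom hX).
have mY t := umom_mom t (mds_umom hY).
have mSX n := mom_psum n (mds_umom hX); have mSY n := mom_psum n (mds_umom hY).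
elim=> [//|n ih]; rewrite leq_eqVlt => /orP[/eqP <-|n2].
  rewrite subrr mul0r -[RHS](Ex_cst P 0).
  by apply: eq_Ex => w; rewrite psum_small// mul0r.
have := ih n2 => {}ih.
transitivity (Ex P (fun w => psum X n w * psum Y n w + psum X n w * Y n.+1%:Z w
    + psum Y n w * X n.+1%:Z w + X n.+1%:Z w * Y n.+1%:Z w)).
  by apply: eq_Ex => w; rewrite !psumS//; ring.
rewrite !ExD ?ih; try by mom_tac.
rewrite hk (_ : Ex P (fun w => psum X n w * Y n.+1%:Z w) = 0); last first.
  by apply: (mds_orth hY) => //; exact: past_psum.
rewrite (_ : Ex P (fun w => psum Y n w * X n.+1%:Z w) = 0); last first.
  by apply: (mds_orth hX) => //; exact: past_psum.
by rewrite -(natr1 n); ring.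
Qed.

(* E (S + X)^4 = E S^4 + 6 E S^2 X^2 + 4 E S X^3 + E X^4, and Young's inequality
   bounds the middle terms by E S^4 / N + 16 N E X^4. *)
Lemma Ex_psum4 X : mds X ->
  exists K : R, forall n, Ex P (fun w => psum X n w ^+ 4) <= K * n%:R ^+ 2.
Proof.
move=> hX; have mX t := umom_mom t (mds_umom hX).
have mS n := mom_psum n (mds_umom hX).
have [c c0 hc] := umom_Ex_bound (umomX 4 (mds_umom hX)).
(* 19 = 16 + 3: the induction hypothesis inflated by 1 + 1/N stays below 19 c (N^2 - N), and the
   remaining 19 c N covers (16 N + 3) c because N >= 1. *)
exists (19 * c); elim=> [|n ih].
  rewrite expr0n mulr0 -[leRHS](Ex_cst P 0) le_eqVlt; apply/orP; left.
  by apply/eqP; apply: eq_Ex => w; rewrite psum_small// expr0n.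
have [n2|n2] := leqP 2 n; last first.
  apply: (@le_trans _ _ 0); last by rewrite !mulr_ge0 ?sqr_ge0// ltW.
  rewrite -[leRHS](Ex_cst P 0) le_eqVlt; apply/orP; left.
  by apply/eqP; apply: eq_Ex => w; rewrite psum_small// expr0n.
set N : R := n.+1%:R; have N1 : 1 <= N by rewrite ler1n.
have N0 : 0 < N by exact: lt_le_trans N1.
set S := psum X n in ih *; set x := X n.+1%:Z.
have mS4 : mom P S by exact: mS.
have mx : mom P x by exact: mX.
have orth : Ex P (fun w => S w ^+ 3 * x w) = 0.
  apply: (mds_orth hX); last by mom_tac.
  by apply: pastX; exact: past_psum.
apply: le_trans (_ : Ex P (fun w => (1 + N^-1) * S w ^+ 4
    + ((16 * N + 3) * x w ^+ 4 + 4 * (S w ^+ 3 * x w))) <= _).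
  apply: Ex_le; [by rewrite (_ : (fun w => _) = fun w => (S w + x w) ^+ 4);
    [mom_tac|apply/funext => w; rewrite psumS]|by mom_tac|].
  move=> w; rewrite psumS// -/S -/x; move: (S w) (x w) => s y.
  have := sqr_ge0 (s ^+ 2 - 4 * N * y ^+ 2).
  have := mulr_ge0 (sqr_ge0 y) (sqr_ge0 (s - y)) => h2 h1.
  rewrite -subr_ge0.
  have -> : (1 + N^-1) * s ^+ 4 + ((16 * N + 3) * y ^+ 4 + 4 * (s ^+ 3 * y))
      - (s + y) ^+ 4
    = N^-1 * (s ^+ 2 - 4 * N * y ^+ 2) ^+ 2 + 2 * (y ^+ 2 * (s - y) ^+ 2).
    by field; rewrite gt_eqF.
  have h3 : 0 <= N^-1 by rewrite invr_ge0 ltW.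
  by apply: addr_ge0; [exact: mulr_ge0|exact: (mulr_ge0 (ler0n _ 2))].
rewrite !ExD ?ExZ ?orth; try by mom_tac.
rewrite mulr0 addr0.
have Ni0 : 0 < N^-1 by rewrite invr_gt0.
have h1 : (1 + N^-1) * Ex P (fun w => S w ^+ 4) <= (1 + N^-1) * (19 * c * (N - 1) ^+ 2).
  rewrite ler_wpM2l ?addr_ge0 ?(ltW Ni0)// (le_trans ih)//.
  by rewrite /N -(natr1 n) addrK.
have h2 : (16 * N + 3) * Ex P (fun w => x w ^+ 4) <= (16 * N + 3) * c.
  by rewrite ler_wpM2l ?hc// addr_ge0// mulr_ge0// ltW.
have h3 : (1 + N^-1) * (19 * c * (N - 1) ^+ 2) <= 19 * c * (N ^+ 2 - N).
  rewrite mulrCA ler_wpM2l ?mulr_ge0// ?(ltW c0)//.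
  rewrite -subr_ge0.
  have -> : N ^+ 2 - N - (1 + N^-1) * (N - 1) ^+ 2 = 1 - N^-1.
    by field; rewrite gt_eqF.
  by rewrite subr_ge0 invf_le1.
apply: le_trans (lerD (le_trans h1 h3) h2) _.
by have := ler_wpM2r (ltW c0) N1; lra.
Qed.

End MartingaleSums.

(** * Score martingales and the population Yule-Walker equations *)

Section Scores.
Context {d : measure_display} {T : measurableType d} {R : realType}.
Variables (P : probability T R) (phi1 phi2 : R) (mu : nat -> R) (g0 g1 g2 : R).
Variables (z : int -> {RV P >-> R}) (e : int -> T -> R).
Hypothesis M : ar2_model phi1 phi2 mu g0 g1 g2 z e.

Definition score1 (t : int) (w : T) : R := e t w * z (t - 1) w.
Definition score2 (t : int) (w : T) : R := e t w * z (t - 2) w.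
Definition noise2 (t : int) (w : T) : R := e t w ^+ 2 - mu 2.

Lemma mom_ar2 t : mom P (z t). Proof. exact: umom_mom (ar2_umom M). Qed.

Lemma umom_innov : umom P e.
Proof.
have mz := ar2_umom M.
rewrite (_ : e = fun t w => z t w + - (phi1 * z (t - 1) w) + - (phi2 * z (t - 2) w)).
  apply: umomD; first apply: umomD => //; apply: umomN; apply: umomM.
  - exact: umom_cst.
  - exact: (umom_reindex (fun t : int => t - 1) mz).
  - exact: umom_cst.
  - exact: (umom_reindex (fun t : int => t - 2) mz).
by apply/funext => t; apply/funext => w; rewrite (ar2_innovE M).
Qed.

Lemma mom_innov t : mom P (e t). Proof. exact: umom_mom umom_innov. Qed.

Lemma past_ar2 (s t : int) : s < t -> past z t (z s).
Proof. exact: past_process. Qed.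

Lemma past_innov (t : int) : past z (t + 1) (e t).
Proof.
rewrite (_ : e t = fun w => z t w + - (phi1 * z (t - 1) w) + - (phi2 * z (t - 2) w)).
  apply: pastD; first apply: pastD.
  - by apply: past_process; rewrite ltrDl.
  - by apply: pastN; apply: pastM; [exact: past_cst|apply: past_process; lia].
  - by apply: pastN; apply: pastM; [exact: past_cst|apply: past_process; lia].
by apply/funext => w; rewrite (ar2_innovE M).
Qed.

Lemma innov_mom1 t X : past z t X -> mom P X -> Ex P (fun w => X w * e t w) = 0.
Proof.
move=> pX mX; have := ar2_innov_moment M 1 pX mX.
by rewrite (ar2_innov_mean M) mul0r => <-; apply: eq_Ex => w; rewrite expr1.
Qed.

Lemma mds_score1 : mds z score1.
Proof.
split.
- apply: umomM; first exact: umom_innov.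
  exact: (umom_reindex (fun t : int => t - 1) (ar2_umom M)).
- by move=> t; apply: pastM; [exact: past_innov|apply: past_process; lia].
- move=> t W pW mW; have mz := mom_ar2 (t - 1).
  rewrite -[RHS](@innov_mom1 t (fun w => W w * z (t - 1) w)).
  + by apply: eq_Ex => w; rewrite /score1; ring.
  + by apply: pastM => //; apply: past_process; lia.
  + by mom_tac.
Qed.

Lemma mds_score2 : mds z score2.
Proof.
split.
- apply: umomM; first exact: umom_innov.
  exact: (umom_reindex (fun t : int => t - 2) (ar2_umom M)).
- by move=> t; apply: pastM; [exact: past_innov|apply: past_process; lia].
- move=> t W pW mW; have mz := mom_ar2 (t - 2).
  rewrite -[RHS](@innov_mom1 t (fun w => W w * z (t - 2) w)).
  + by apply: eq_Ex => w; rewrite /score2; ring.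
  + by apply: pastM => //; apply: past_process; lia.
  + by mom_tac.
Qed.

Lemma mds_noise2 : mds z noise2.
Proof.
split.
- apply: umomD; first by apply: umomX; exact: umom_innov.
  by apply: umomN; exact: umom_cst.
- move=> t; apply: pastD; first by apply: pastX; exact: past_innov.
  by apply: pastN; exact: past_cst.
- move=> t W pW mW; have me := mom_innov t.
  transitivity (Ex P (fun w => W w * e t w ^+ 2 - mu 2 * W w)).
    by apply: eq_Ex => w; rewrite /noise2; ring.
  by rewrite ExB ?ExZ ?(ar2_innov_moment M)// ?subrr//; mom_tac.
Qed.

Lemma Ex_score11 t : Ex P (fun w => score1 t w * score1 t w) = mu 2 * g0.
Proof.
have mz := mom_ar2 (t - 1); rewrite -(ar2_cov0 M (t - 1)) -(ar2_innov_moment M 2 (t := t)).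
- by apply: eq_Ex => w; rewrite /score1; ring.
- by apply: pastM; apply: past_process; lia.
- by mom_tac.
Qed.

Lemma Ex_score22 t : Ex P (fun w => score2 t w * score2 t w) = mu 2 * g0.
Proof.
have mz := mom_ar2 (t - 2); rewrite -(ar2_cov0 M (t - 2)) -(ar2_innov_moment M 2 (t := t)).
- by apply: eq_Ex => w; rewrite /score2; ring.
- by apply: pastM; apply: past_process; lia.
- by mom_tac.
Qed.

Lemma Ex_score12 t : Ex P (fun w => score1 t w * score2 t w) = mu 2 * g1.
Proof.
have mz := mom_ar2 (t - 1); have mz2 := mom_ar2 (t - 2).
have tE : t - 1 - 1 = t - 2 by ring.
rewrite -(ar2_cov1 M (t - 1)) tE -(ar2_innov_moment M 2 (t := t)).
- by apply: eq_Ex => w; rewrite /score1 /score2; ring.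
- by apply: pastM; apply: past_process; lia.
- by mom_tac.
Qed.

(** The third moment [mu 3] comes multiplied by the mean of z, which is 0. *)
Let Ex_lag_noise2 (t s : int) : s < t ->
  Ex P (fun w => e t w * z s w * noise2 t w) = 0.
Proof.
move=> st; have mz := mom_ar2 s; have me := mom_innov t; have pz := past_ar2 st.
transitivity (Ex P (fun w => z s w * e t w ^+ 3 - mu 2 * (z s w * e t w))).
  by apply: eq_Ex => w; rewrite /noise2; ring.
rewrite ExB ?ExZ ?(ar2_innov_moment M 3 pz)//; try by mom_tac.
by rewrite (innov_mom1 pz mz) (ar2_mean M) !mulr0 subr0.
Qed.

Lemma Ex_score1_noise2 t : Ex P (fun w => score1 t w * noise2 t w) = 0.
Proof. by apply: Ex_lag_noise2; lia. Qed.

Lemma Ex_score2_noise2 t : Ex P (fun w => score2 t w * noise2 t w) = 0.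
Proof. by apply: Ex_lag_noise2; lia. Qed.

Let Ex_rec (t s : int) : s < t -> Ex P (fun w => z t w * z s w) =
  phi1 * Ex P (fun w => z (t - 1) w * z s w) + phi2 * Ex P (fun w => z (t - 2) w * z s w).
Proof.
move=> st; have mz := mom_ar2; have me := mom_innov t; have pz := past_ar2 st.
rewrite -!ExZ; try by mom_tac.
rewrite -ExD; try by mom_tac.
rewrite -[LHS]subr0 -(innov_mom1 pz (mz s)) -ExB; try by mom_tac.
by apply: eq_Ex => w; rewrite (ar2_innovE M); ring.
Qed.

Lemma yule_walker1 : g1 = phi1 * g0 + phi2 * g1.
Proof.
rewrite -{1}(ar2_cov1 M 0) Ex_rec; last by lia.
rewrite (ar2_cov0 M) (_ : (0 - 2 : int) = 0 - 1 - 1)//; congr (_ + _ * _).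
by rewrite -(ar2_cov1 M (0 - 1)); apply: eq_Ex => w; rewrite mulrC.
Qed.

Lemma yule_walker2 : g2 = phi1 * g1 + phi2 * g0.
Proof.
rewrite -{1}(ar2_cov2 M 0) Ex_rec; last by lia.
by rewrite (ar2_cov0 M) (_ : (0 - 2 : int) = 0 - 1 - 1)// (ar2_cov1 M).
Qed.

Lemma yule_walker0 : g0 = phi1 * g1 + phi2 * g2 + mu 2.
Proof.
have mz := mom_ar2; have me := mom_innov 0.
have ve : Ex P (fun w => z 0 w * e 0 w) = mu 2.
  transitivity (Ex P (fun w => phi1 * (z (0 - 1) w * e 0 w)
      + (phi2 * (z (0 - 2) w * e 0 w) + e 0 w ^+ 2))).
    apply: eq_Ex => w; have := ar2_innovE M 0 w.
    move: (e 0 w) (z 0 w) (z (0 - 1) w) (z (0 - 2) w) => ew z0 z1 z2 ->; ring.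
  rewrite !ExD ?ExZ; try by mom_tac.
  have p1 : past z 0 (z (0 - 1)) by apply: past_process; lia.
  have p2 : past z 0 (z (0 - 2)) by apply: past_process; lia.
  rewrite (innov_mom1 p1 (mz _)) (innov_mom1 p2 (mz _)).
  have e2 : Ex P (fun w => e 0 w ^+ 2) = mu 2.
    have := ar2_innov_moment M 2 (@past_cst _ _ _ P z 0 1) (mom_cst P 1).
    by rewrite Ex_cst mulr1 => <-; apply: eq_Ex => w; rewrite mul1r.
  by rewrite e2; ring.
rewrite -{1}(ar2_cov0 M 0) -(ar2_cov1 M 0) -(ar2_cov2 M 0) -ve.
rewrite -!ExZ; try by mom_tac.
rewrite -!ExD; try by mom_tac.
apply: eq_Ex => w; have := ar2_innovE M 0 w.
move: (e 0 w) (z 0 w) (z (0 - 1) w) (z (0 - 2) w) => ew z0 z1 z2 ->; ring.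
Qed.

End Scores.

(** * Stochastic orders *)

Section StochasticOrders.
Context {d : measure_display} {T : measurableType d} {R : realType}.
Variable P : probability T R.
Implicit Types (X Y : nat -> T -> R) (c : nat -> R) (p : nat).

(** The rate [c] bounds the p-th absolute moment, not the L^p norm. Starting at n = 4 keeps n - 1
    and n - 2 positive with inverses at most 2/n. *)
Definition Ord p c X : Prop := exists K : R, forall n, (3 < n)%N ->
  mom P (X n) /\ Ex P (fun w => `|X n w| ^+ p) <= K * c n.

Definition rate32 (n : nat) : R := (n%:R * Num.sqrt n%:R)^-1.

(* O1: standardised size n^{-1/2}, in L^4;  O2: size n^{-1}, in L^2;
   O3: size n^{-3/2}, in L^1;  Oedge: size n^{-1}, in L^4. *)
Definition O1 := Ord 4 (fun n => n%:R ^- 2).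
Definition O2 := Ord 2 (fun n => n%:R ^- 2).
Definition O3 := Ord 1 rate32.
Definition Oedge := Ord 4 (fun n => n%:R ^- 4).

Definition o3 (u : nat -> R) : Prop := exists K : R, forall n, (3 < n)%N ->
  `|u n| <= K * rate32 n.

Lemma Ord_mom p c X n : Ord p c X -> (3 < n)%N -> mom P (X n).
Proof. by case=> K h n3; case: (h n n3). Qed.

Lemma OrdE p c X Y : (forall n w, (3 < n)%N -> Y n w = X n w) ->
  Ord p c X -> Ord p c Y.
Proof.
move=> h [K hK]; exists K => n n3; rewrite (_ : Y n = X n); first exact: hK.
by apply/funext => w; exact: h.
Qed.

Lemma OrdD p c X Y : Ord p c X -> Ord p c Y -> Ord p c (fun n w => X n w + Y n w).
Proof.
move=> [K hK] [L hL]; exists (2 ^+ p * (K + L)) => n n3.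
have [mX {}hK] := hK n n3; have [mY {}hL] := hL n n3; split; first by mom_tac.
apply: le_trans (_ : Ex P (fun w => 2 ^+ p * (`|X n w| ^+ p + `|Y n w| ^+ p)) <= _).
  by apply: Ex_le; [mom_tac|mom_tac|move=> w; exact: normrD_pow_le].
rewrite ExZ ?ExD; try by mom_tac.
by rewrite -mulrA mulrDl ler_wpM2l ?exprn_ge0// lerD.
Qed.

(** This is where the bounds on the estimators pay: an error known only to be bounded can multiply a
    small factor without spoiling its order. *)
Lemma Ord_bounded p c (b : nat -> T -> R) (M : R) X :
  (forall n, (3 < n)%N -> mom P (b n)) -> (forall n w, (3 < n)%N -> `|b n w| <= M) ->
  Ord p c X -> Ord p c (fun n w => b n w * X n w).
Proof.
move=> mb bM [K hK]; exists (M ^+ p * K) => n n3.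
have [mX {}hK] := hK n n3; have mbn := mb n n3; split; first by mom_tac.
(* A negative [M] forces the sample space to be empty, which no probability measure allows. *)
have [M0|M0] := leP 0 M; last first.
  have w0 : T -> False.
    by move=> w; have := bM n w n3; rewrite leNgt (lt_le_trans M0).
  have z0 (f : T -> R) : Ex P f = 0.
    rewrite (_ : f = fun=> 0) ?Ex_cst//.
    by apply/funext => w; case: (w0 w).
  by have := Ex_cst P (1 : R); rewrite z0 => /esym/eqP; rewrite oner_eq0.
apply: le_trans (_ : Ex P (fun w => M ^+ p * `|X n w| ^+ p) <= _).
  apply: Ex_le; [mom_tac|mom_tac|move=> w].
  by rewrite normrM exprMn ler_wpM2r ?exprn_ge0// lerXn2r ?nnegrE// bM.
by rewrite ExZ; [rewrite -mulrA ler_wpM2l ?exprn_ge0|mom_tac].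
Qed.

Lemma OrdZ p c (k : R) X : Ord p c X -> Ord p c (fun n w => k * X n w).
Proof.
by apply: (@Ord_bounded p c (fun _ _ => k) `|k|) => // n _; exact: mom_cst.
Qed.

Lemma OrdN p c X : Ord p c X -> Ord p c (fun n w => - X n w).
Proof. by move/(OrdZ (-1)); apply: OrdE => n w _; rewrite mulN1r. Qed.

Lemma OrdB p c X Y : Ord p c X -> Ord p c Y -> Ord p c (fun n w => X n w - Y n w).
Proof. by move=> hX hY; apply: OrdD => //; exact: OrdN. Qed.

Lemma norm4 (x : R) : `|x| ^+ 4 = x ^+ 4.
Proof. by rewrite -normrX ger0_norm// (exprM x 2 2) sqr_ge0. Qed.

Lemma norm2 (x : R) : `|x| ^+ 2 = x ^+ 2.
Proof. by rewrite real_normK ?num_real. Qed.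

Lemma Ex_norm_pow4 (f : T -> R) : Ex P (fun w => `|f w| ^+ 4) = Ex P (fun w => f w ^+ 4).
Proof. by apply: eq_Ex => w; exact: norm4. Qed.

Lemma Ex_norm_pow2 (f : T -> R) : Ex P (fun w => `|f w| ^+ 2) = Ex P (fun w => f w ^+ 2).
Proof. by apply: eq_Ex => w; exact: norm2. Qed.

Lemma O1M X Y : O1 X -> O1 Y -> O2 (fun n w => X n w * Y n w).
Proof.
move=> [K hK] [L hL]; exists (K + L) => n n3.
have [mX {}hK] := hK n n3; have [mY {}hL] := hL n n3; split; first by mom_tac.
rewrite mulrDl; apply: le_trans (lerD hK hL).
rewrite Ex_norm_pow2 !Ex_norm_pow4 -ExD; try by mom_tac.
apply: Ex_le; [mom_tac|mom_tac|move=> w]; rewrite exprMn.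
have := sqr_ge0 (X n w ^+ 2 - Y n w ^+ 2).
have := sqr_ge0 (X n w ^+ 2); have := sqr_ge0 (Y n w ^+ 2).
rewrite -!exprM; nra.
Qed.

(** A weighted form of Hölder's inequality with s = sqrt n: |x y| <= x^2/s + s y^2 and x^2 <= 1/n +
    n x^4 balance the sizes, so that every resulting term is of order n^(-3/2). *)
Lemma O12M X Y : O1 X -> O2 Y -> O3 (fun n w => X n w * Y n w).
Proof.
move=> [K hK] [L hL]; exists (1 + K + L) => n n3.
have [mX {}hK] := hK n n3; have [mY {}hL] := hL n n3; split; first by mom_tac.
have N0 : (0 : R) < n%:R by rewrite ltr0n (ltn_trans _ n3).
pose N : R := n%:R; pose s : R := Num.sqrt N.
have s0 : 0 < s by rewrite sqrtr_gt0.
have sN : s ^+ 2 = N by rewrite sqr_sqrtr// ltW.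
apply: le_trans (_ : Ex P (fun w => s^-1 * (N^-1 + N * X n w ^+ 4) + s * Y n w ^+ 2) <= _).
  apply: Ex_le; [mom_tac|mom_tac|move=> w]; rewrite expr1.
  set x := X n w; set y := Y n w.
  have h1 : `|x * y| <= s^-1 * x ^+ 2 + s * y ^+ 2.
    rewrite normrM -(norm2 x) -(norm2 y).
    have -> : s^-1 * `|x| ^+ 2 + s * `|y| ^+ 2
        = `|x| * `|y| + (s^-1 * (`|x| - s * `|y|) ^+ 2 + `|x| * `|y|).
      by field; rewrite gt_eqF.
    by rewrite lerDl addr_ge0// mulr_ge0 ?sqr_ge0// invr_ge0 ltW.
  apply: (le_trans h1); rewrite lerD2r ler_wpM2l ?invr_ge0 ?(ltW s0)//.
  have -> : N^-1 + N * x ^+ 4 = x ^+ 2 + (N^-1 * (1 - N * x ^+ 2) ^+ 2 + x ^+ 2).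
    by field; rewrite gt_eqF.
  by rewrite lerDl addr_ge0 ?sqr_ge0// mulr_ge0 ?sqr_ge0// invr_ge0 ltW.
rewrite !(ExD, ExZ, Ex_cst); try by mom_tac.
rewrite Ex_norm_pow4 in hK; rewrite Ex_norm_pow2 in hL.
have -> : (1 + K + L) * rate32 n
    = s^-1 * (N^-1 + N * (K * N ^- 2)) + s * (L * N ^- 2).
  rewrite /rate32 -/N -/s.
  have -> : s * (L * N ^- 2) = s^-1 * (L * N^-1).
    by rewrite -sN; field; rewrite gt_eqF.
  by field; rewrite !gt_eqF.
rewrite lerD//; last by rewrite ler_wpM2l// ltW.
by rewrite ler_wpM2l ?invr_ge0 ?(ltW s0)// lerD2l ler_wpM2l// ltW.
Qed.

Lemma O21M X Y : O2 X -> O1 Y -> O3 (fun n w => X n w * Y n w).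
Proof.
by move=> hX hY; apply: OrdE (O12M hY hX) => n w _; rewrite mulrC.
Qed.

Lemma Oedge_O1 X : Oedge X -> O1 X.
Proof.
move=> [K hK]; exists `|K| => n n3; have [mX {}hK] := hK n n3; split=> //.
have N1 : (1 : R) <= n%:R by rewrite ler1n (leq_trans _ n3).
have N0 : (0 : R) < n%:R by exact: lt_le_trans N1.
apply: (le_trans hK); apply: le_trans (_ : `|K| * n%:R ^- 4 <= _).
  by rewrite ler_wpM2r ?ler_norm// invr_ge0 exprn_ge0 ?ltW.
rewrite ler_wpM2l// lef_pV2 ?posrE ?exprn_gt0//.
by apply: ler_weXn2l.
Qed.

Lemma Oedge_O2 X : Oedge X -> O2 X.
Proof.
move=> [K hK]; exists (1 + K) => n n3; have [mX {}hK] := hK n n3; split=> //.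
have N0 : (0 : R) < n%:R by rewrite ltr0n (ltn_trans _ n3).
pose N : R := n%:R.
apply: le_trans (_ : Ex P (fun w => N ^- 2 + N ^+ 2 * X n w ^+ 4) <= _).
  apply: Ex_le; [mom_tac|mom_tac|move=> w]; rewrite norm2; set x := X n w.
  have -> : N ^- 2 + N ^+ 2 * x ^+ 4
      = x ^+ 2 + (N ^- 2 * (1 - N ^+ 2 * x ^+ 2) ^+ 2 + x ^+ 2).
    by field; rewrite gt_eqF.
  by rewrite lerDl addr_ge0 ?sqr_ge0// mulr_ge0 ?sqr_ge0// invr_ge0 exprn_ge0 ?ltW.
rewrite !(ExD, ExZ, Ex_cst); try by mom_tac.
rewrite Ex_norm_pow4 in hK.
have -> : (1 + K) * n%:R ^- 2 = N ^- 2 + N ^+ 2 * (K * N ^- 4).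
  by rewrite -/N; field; rewrite gt_eqF.
by rewrite lerD2l ler_wpM2l// exprn_ge0 ?ltW.
Qed.

Lemma O1_scale (c : nat -> R) X : (forall n, (3 < n)%N -> `|c n| <= 2 / n%:R) ->
  O1 X -> Oedge (fun n w => c n * X n w).
Proof.
move=> hc [K hK]; exists (16 * `|K|) => n n3; have [mX {}hK] := hK n n3.
split; first by mom_tac.
have N1 : (1 : R) <= n%:R by rewrite ler1n (leq_trans _ n3).
have N0 : (0 : R) < n%:R by exact: lt_le_trans N1.
apply: le_trans (_ : Ex P (fun w => `|c n| ^+ 4 * `|X n w| ^+ 4) <= _).
  by apply: Ex_le; [mom_tac|mom_tac|move=> w; rewrite normrM exprMn].
rewrite ExZ; last by mom_tac.
have EX0 : 0 <= Ex P (fun w => `|X n w| ^+ 4).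
  by apply: Ex_ge0 => w; rewrite exprn_ge0.
have c4 : `|c n| ^+ 4 <= (2 / n%:R) ^+ 4.
  by apply: lerXn2r; rewrite ?nnegrE ?hc// divr_ge0// ltW.
apply: (le_trans (ler_wpM2r EX0 c4)).
have -> : 16 * `|K| * n%:R ^- 4 = (2 / n%:R) ^+ 4 * `|K|.
  by field; rewrite gt_eqF.
rewrite ler_wpM2l ?exprn_ge0 ?divr_ge0 ?(ltW N0)//.
have i0 : 0 <= (n%:R : R) ^- 2 by rewrite invr_ge0 exprn_ge0 ?ltW.
apply: (le_trans hK); apply: (le_trans (ler_wpM2r i0 (ler_norm K))).
by rewrite ler_piMr// invf_le1 ?exprn_gt0// exprn_ege1.
Qed.

Lemma Oedge_umom (I : Type) (f : I -> T -> R) (ix : nat -> I) (c : nat -> R) :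
  (forall n, (3 < n)%N -> `|c n| <= 2 / n%:R) -> umom P f ->
  Oedge (fun n w => c n * f (ix n) w).
Proof.
move=> hc mf; have [K K0 hK] := umom_Ex_bound (umomX 4 (umom_norm mf)).
exists (16 * K) => n n3; have mfn : mom P (f (ix n)) by exact: umom_mom mf.
split; first by mom_tac.
have N0 : (0 : R) < n%:R by rewrite ltr0n (ltn_trans _ n3).
apply: le_trans (_ : Ex P (fun w => `|c n| ^+ 4 * `|f (ix n) w| ^+ 4) <= _).
  by apply: Ex_le; [mom_tac|mom_tac|move=> w; rewrite normrM exprMn].
rewrite ExZ; last by mom_tac.
have -> : 16 * K * n%:R ^- 4 = (2 / n%:R) ^+ 4 * K by field; rewrite gt_eqF.
apply: ler_pM.
- exact: exprn_ge0.
- by apply: Ex_ge0 => w; rewrite exprn_ge0.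
- by apply: lerXn2r; rewrite ?nnegrE ?hc// divr_ge0// ltW.
- exact: hK.
Qed.

Lemma O3_Ex X : O3 X -> o3 (fun n => Ex P (X n)).
Proof.
move=> [K hK]; exists K => n n3; have [mX {}hK] := hK n n3.
apply: (le_trans (Ex_norm mX)); apply: le_trans hK.
by rewrite le_eqVlt; apply/orP; left; apply/eqP; apply: eq_Ex => w; rewrite expr1.
Qed.

Lemma o3E (u v : nat -> R) : (forall n, (3 < n)%N -> v n = u n) -> o3 u -> o3 v.
Proof. by move=> h [K hK]; exists K => n n3; rewrite h// hK. Qed.

Lemma o3D (u v : nat -> R) : o3 u -> o3 v -> o3 (fun n => u n + v n).
Proof.
move=> [K hK] [L hL]; exists (K + L) => n n3.
by rewrite (le_trans (ler_normD _ _))// mulrDl lerD ?hK ?hL.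
Qed.

Lemma o3Z (k : R) (u : nat -> R) : o3 u -> o3 (fun n => k * u n).
Proof.
move=> [K hK]; exists (`|k| * K) => n n3.
by rewrite normrM -mulrA ler_wpM2l ?hK.
Qed.

Lemma o3N (u : nat -> R) : o3 u -> o3 (fun n => - u n).
Proof. by move/(o3Z (-1)); apply: o3E => n _; rewrite mulN1r. Qed.

Lemma o3B (u v : nat -> R) : o3 u -> o3 v -> o3 (fun n => u n - v n).
Proof. by move=> hu hv; apply: o3D => //; exact: o3N. Qed.

(** Exact covariances of averages carry 1/(n - 2), while the bias is stated with 1/n; the
    discrepancy is of order n^(-2). *)
Lemma o3_shift : o3 (fun n => (n%:R - 2)^-1 - n%:R^-1).
Proof.
exists 4 => n n3; pose N : R := n%:R; have N4 : 4 <= N by rewrite ler_nat.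
have N0 : 0 < N by lra.
have N2 : 0 < N - 2 by lra.
rewrite -/N (_ : (N - 2)^-1 - N^-1 = 2 / (N * (N - 2))); last first.
  by field; rewrite !gt_eqF.
rewrite ger0_norm; last by rewrite divr_ge0// mulr_ge0// ltW.
have s0 : 0 < Num.sqrt N by rewrite sqrtr_gt0.
rewrite /rate32 -/N ler_pdivrMr ?mulr_gt0// mulrAC ler_pdivlMr ?mulr_gt0//.
have sN : Num.sqrt N <= N.
  rewrite -[leRHS]sqr_sqrtr ?(ltW N0)// expr2 ler_peMl ?(ltW s0)//.
  by rewrite -sqrtr1 ler_wsqrtr//; lra.
apply: le_trans (_ : 2 * (N * N) <= _).
  by rewrite ler_wpM2l// ler_wpM2l// ltW.
have -> : 4 * (N * (N - 2)) = 2 * (N * N) + 2 * (N * (N - 4)) by ring.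
by rewrite lerDl mulr_ge0// mulr_ge0 ?subr_ge0// ltW.
Qed.

End StochasticOrders.

(** * Algebra of the Burg estimators *)

Section BurgIdentities.
Context {R : realType}.
Variables (x : int -> R) (n : nat).
Hypothesis n3 : (3 < n)%N.

Local Notation C := (burgC x n).
Local Notation D := (burgD x n).
Local Notation E := (burgE x n).
Local Notation F := (burgF x n).
Local Notation G := (burgG x n).
Local Notation H := (burgH x n).

Definition burg_refl : R := 2 * F / D.

Let c2_gt0 : 0 < (n%:R - 2 : R)^-1.
Proof. by rewrite invr_gt0 subr_gt0 ltr_nat (ltn_trans _ n3). Qed.

Let c1_gt0 : 0 < (n%:R - 1 : R)^-1.
Proof. by rewrite invr_gt0 subr_gt0 ltr1n (ltn_trans _ n3). Qed.

Let sq_le (a b : R) : `|2 * (a * b)| <= a ^+ 2 + b ^+ 2.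
Proof.
by rewrite ler_norml; have := sqr_ge0 (a + b); have := sqr_ge0 (a - b);
  move=> h1 h2; apply/andP; split; nra.
Qed.

Lemma burg_F_le : `|2 * F| <= D.
Proof.
rewrite /burgF /burgD mulrCA normrM (gtr0_norm c1_gt0) ler_wpM2l ?(ltW c1_gt0)//.
rewrite mulr_sumr (le_trans (ler_norm_sum _ _ _))//.
by apply: ler_sum => t _; exact: sq_le.
Qed.

(** Total division does no harm: where D = 0, [burg_F_le] forces F = 0. *)
Lemma burg_refl_mul : burg_refl * D = 2 * F.
Proof.
rewrite /burg_refl; have [D0|D0] := eqVneq D 0; last by rewrite divfK.
have := burg_F_le; rewrite D0 normr_le0 => /eqP ->.
by rewrite mulr0.
Qed.

Lemma burg_refl_le1 : `|burg_refl| <= 1.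
Proof.
rewrite /burg_refl; have [->|D0] := eqVneq D 0; first by rewrite invr0 mulr0 normr0.
have Dge0 : 0 <= D by exact: le_trans (normr_ge0 _) burg_F_le.
rewrite normrM normfV (ger0_norm Dge0) ler_pdivrMr ?mul1r ?burg_F_le//.
by rewrite lt_neqAle eq_sym D0.
Qed.

Let r := burg_refl.

(** With forward residuals x_t - r x_(t-1) and backward residuals x_(t-2) - r x_(t-1), [burg_Q]
    averages the sum of their squares and [burg_N] twice their product; [burg_phi2] is the ratio N/Q
    wherever Q is nonzero. *)
Definition burg_Q : R := C - 2 * r * H + 2 * r ^+ 2 * G.
Definition burg_N : R := 2 * E - 2 * r * H + 2 * r ^+ 2 * G.

Let burg_QE : burg_Q = (n%:R - 2)^-1 * \sum_(3 <= t < n.+1)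
  ((x t%:Z - r * x (t%:Z - 1)) ^+ 2 + (x (t%:Z - 2) - r * x (t%:Z - 1)) ^+ 2).
Proof.
rewrite /burg_Q /burgC /burgH /burgG.
rewrite (mulrCA (2 * r)) (mulrCA (2 * r ^+ 2)) -mulrBr -mulrDr; congr (_ * _).
rewrite !mulr_sumr -sumrB -big_split/=; apply: eq_bigr => t _; ring.
Qed.

Let burg_NE : burg_N = (n%:R - 2)^-1 * \sum_(3 <= t < n.+1)
  (2 * ((x t%:Z - r * x (t%:Z - 1)) * (x (t%:Z - 2) - r * x (t%:Z - 1)))).
Proof.
rewrite /burg_N /burgE /burgH /burgG.
rewrite (mulrCA 2 _ (\sum_(_ <= _ < _) _)).
rewrite (mulrCA (2 * r)) (mulrCA (2 * r ^+ 2)) -mulrBr -mulrDr; congr (_ * _).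
rewrite !mulr_sumr -sumrB -big_split/=; apply: eq_bigr => t _; ring.
Qed.

Lemma burg_N_le : `|burg_N| <= burg_Q.
Proof.
rewrite burg_NE burg_QE normrM (gtr0_norm c2_gt0) ler_wpM2l ?(ltW c2_gt0)//.
rewrite (le_trans (ler_norm_sum _ _ _))//.
by apply: ler_sum => t _; exact: sq_le.
Qed.

Let burgD_eq0 : D = 0 -> forall t, (1 <= t < n.+1)%N -> x t%:Z = 0.
Proof.
rewrite /burgD => /eqP; rewrite mulf_eq0 (gt_eqF c1_gt0)/= => /eqP D0.
have h t : (2 <= t < n.+1)%N -> x t%:Z ^+ 2 + x (t%:Z - 1) ^+ 2 = 0.
  move=> tn; move/eqP: D0.
  rewrite psumr_eq0 => [/allP /(_ t)|i _]; last by rewrite addr_ge0 ?sqr_ge0.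
  by rewrite mem_index_iota tn => /(_ isT) /eqP.
have x0 t : (2 <= t < n.+1)%N -> x t%:Z = 0 /\ x (t%:Z - 1) = 0.
  move=> /h /eqP; rewrite paddr_eq0 ?sqr_ge0// !sqrf_eq0.
  by move=> /andP[/eqP ? /eqP ?].
move=> t /andP[t1 tn]; have [t2|t2] := leqP 2 t.
  by have [] := x0 t; rewrite // t2 tn.
have -> : (t%:Z = 2%:Z - 1)%R by lia.
by have [|_ ->] := x0 2%N; first by lia.
Qed.

Let burg_degenerate : D = 0 -> C = 0 /\ E = 0.
Proof.
move=> /burgD_eq0 x0; have x2 t : (3 <= t < n.+1)%N -> x t%:Z = 0 /\ x (t%:Z - 2) = 0.
  move=> tn; split; first by apply: x0; lia.
  by rewrite (_ : t%:Z - 2 = (t - 2)%N%:Z); [apply: x0; lia|lia].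
rewrite /burgC /burgE !big_nat !big1 ?mulr0// => t /x2[-> ->].
  by rewrite mulr0.
by rewrite expr0n addr0.
Qed.

(** Substituting 2 F = r D makes D^2 a common factor of the original fraction. Where D = 0 the
    observed path vanishes and both sides are 1. *)
Lemma burg_phi2E : burg_phi2 x n = 1 - (burg_Q - burg_N) / burg_Q.
Proof.
have QN : burg_Q - burg_N = C - 2 * E by rewrite /burg_Q /burg_N; ring.
have den : C * D ^+ 2 + 8 * F ^+ 2 * G - 4 * F * H * D = D ^+ 2 * burg_Q.
  rewrite /burg_Q -/r.
  have -> : 8 * F ^+ 2 * G = 2 * (2 * F) ^+ 2 * G by ring.
  have -> : 4 * F * H * D = 2 * (2 * F) * H * D by ring.
  by rewrite -burg_refl_mul -/r; ring.
rewrite /burg_phi2 den QN; congr (1 - _).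
have [D0|D0] := eqVneq D 0.
  by have [-> ->] := burg_degenerate D0; rewrite mulr0 !mul0r subrr !mul0r.
have -> : C * D ^+ 2 - 2 * E * D ^+ 2 = D ^+ 2 * (C - 2 * E) by ring.
by rewrite -mulf_div divff ?mul1r// expf_neq0.
Qed.

Lemma burg_phi2_mul : burg_phi2 x n * burg_Q = burg_N.
Proof.
rewrite burg_phi2E; have [Q0|Q0] := eqVneq burg_Q 0.
  by have := burg_N_le; rewrite Q0 normr_le0 => /eqP ->; rewrite mulr0.
by rewrite mulrBl mul1r divfK// subKr.
Qed.

Lemma burg_phi2_le1 : `|burg_phi2 x n| <= 1.
Proof.
have [Q0|Q0] := eqVneq burg_Q 0.
  by rewrite burg_phi2E Q0 invr0 mulr0 subr0 normr1.
have Qge0 : 0 <= burg_Q by exact: le_trans (normr_ge0 _) burg_N_le.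
have Qgt0 : 0 < burg_Q by rewrite lt_neqAle eq_sym Q0.
rewrite -(ler_pM2r Qgt0) mul1r -{1}(gtr0_norm Qgt0) -normrM burg_phi2_mul.
exact: burg_N_le.
Qed.

End BurgIdentities.

(** * Linearisation of the sample autocovariances *)

(** Here a0, a1, a2 stand for the centred sample autocovariances and r1, r2, r3 for edge terms; k is
    the ratio of innovation variance to process variance. *)
Lemma linear_solve (R : fieldType) (phi1 phi2 rho a0 a1 a2 r1 r2 r3 U1 U2 V : R) :
  1 - phi2 != 0 -> 1 + phi2 != 0 -> 1 - rho ^+ 2 != 0 -> phi1 = rho * (1 - phi2) ->
  a1 + r1 = phi1 * a0 + phi2 * a1 + U1 ->
  a2 = phi1 * a1 + phi2 * (a0 - r3) + U2 ->
  a0 + r2 = phi1 * (a1 + r1) + phi2 * a2 + phi1 * U1 + phi2 * U2 + V ->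
  let k := (1 - phi2) * (1 + phi2) * (1 - rho ^+ 2) in
  a0 = k^-1 * (2 * rho * U1 + 2 * phi2 * U2 + V)
       + k^-1 * (- (2 * rho * phi2) * r1 + - phi2 ^+ 2 * r3 + -1 * r2)
  /\ a1 = rho * a0 + (1 - phi2)^-1 * U1 + - (1 - phi2)^-1 * r1.
Proof.
move=> h1 h2 h3 ->.
(* Eliminating U1, U2, V in favour of the autocovariances turns both conclusions into rational
   identities. *)
have e1 : a1 + r1 = rho * (1 - phi2) * a0 + phi2 * a1 + U1 ->
    U1 = a1 + r1 - rho * (1 - phi2) * a0 - phi2 * a1 by move=> ->; ring.
move=> /e1 E1.
have e2 : a2 = rho * (1 - phi2) * a1 + phi2 * (a0 - r3) + U2 ->
    U2 = a2 - rho * (1 - phi2) * a1 - phi2 * (a0 - r3) by move=> ->; ring.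
move=> /e2 E2 E3.
have -> : V = a0 + r2 - rho * (1 - phi2) * (a1 + r1) - phi2 * a2
    - rho * (1 - phi2) * U1 - phi2 * U2 by rewrite E3; ring.
by rewrite E2 E1; split; field; rewrite ?h1 ?h2 ?h3.
Qed.

Section SampleMoments.
Context {d : measure_display} {T : measurableType d} {R : realType}.
Variables (P : probability T R) (phi1 phi2 : R) (mu : nat -> R) (g0 g1 g2 : R).
Variables (z : int -> {RV P >-> R}) (e : int -> T -> R).
Hypothesis M : ar2_model phi1 phi2 mu g0 g1 g2 z e.

Definition avg (X : int -> T -> R) (n : nat) (w : T) : R := (n%:R - 2)^-1 * psum X n w.

Let path (w : T) (t : int) : R := z t w.

Let sz := umom_reindex (fun t : int => t - 1) (ar2_umom M).
Let sz2 := umom_reindex (fun t : int => t - 2) (ar2_umom M).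

Lemma inv_shift2_le (n : nat) : (3 < n)%N -> `|(n%:R - 2 : R)^-1| <= 2 / n%:R.
Proof.
move=> n3; have N4 : (4 : R) <= n%:R by rewrite ler_nat.
rewrite ger0_norm ?invr_ge0; last by lra.
by rewrite ler_pdivlMr ?ler_pdivrMl; lra.
Qed.

Lemma inv_shift1_le (n : nat) : (3 < n)%N -> `|(n%:R - 1 : R)^-1| <= 2 / n%:R.
Proof.
move=> n3; have N4 : (4 : R) <= n%:R by rewrite ler_nat.
rewrite ger0_norm ?invr_ge0; last by lra.
by rewrite ler_pdivlMr ?ler_pdivrMl; lra.
Qed.

Lemma avg_O1 X : mds z X -> O1 P (avg X).
Proof.
move=> hX; have [K hK] := Ex_psum4 hX; exists (16 * `|K|) => n n3.
have mS := mom_psum n (mds_umom hX).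
split; first by rewrite /avg; mom_tac.
have N0 : (0 : R) < n%:R by rewrite ltr0n (ltn_trans _ n3).
have -> : Ex P (fun w => `|avg X n w| ^+ 4)
    = Ex P (fun w => `|(n%:R - 2)^-1| ^+ 4 * psum X n w ^+ 4).
  by apply: eq_Ex => w; rewrite /avg normrM exprMn (norm4 (psum X n w)).
rewrite ExZ; last by mom_tac.
have -> : 16 * `|K| * n%:R ^- 2 = (2 / n%:R) ^+ 4 * (`|K| * n%:R ^+ 2).
  by field; rewrite gt_eqF.
apply: ler_pM.
- exact: exprn_ge0.
- by apply: Ex_ge0 => w; rewrite (exprM _ 2 2) sqr_ge0.
- by apply: lerXn2r; rewrite ?nnegrE ?inv_shift2_le// divr_ge0// ltW.
- by rewrite (le_trans (hK n))// ler_wpM2r ?sqr_ge0// ler_norm.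
Qed.

Lemma Ex_avgM X Y (k : R) n : (3 < n)%N -> mds z X -> mds z Y ->
  (forall t, Ex P (fun w => X t w * Y t w) = k) ->
  Ex P (fun w => avg X n w * avg Y n w) = k * (n%:R - 2)^-1.
Proof.
move=> n3 hX hY hk; have mX := mom_psum n (mds_umom hX).
have mY := mom_psum n (mds_umom hY).
have n0 : (n%:R - 2 : R) != 0 by rewrite gt_eqF// subr_gt0 ltr_nat (ltn_trans _ n3).
transitivity (Ex P (fun w => (n%:R - 2) ^- 2 * (psum X n w * psum Y n w))).
  by apply: eq_Ex => w; rewrite /avg -exprVn; ring.
rewrite ExZ; last by mom_tac.
rewrite (Ex_psumM hX hY hk); last by lia.
by field.
Qed.

Lemma Ex_avg X (k : R) n : (3 < n)%N -> umom P X ->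
  (forall t, Ex P (X t) = k) -> Ex P (avg X n) = k.
Proof.
move=> n3 mX hk; have n0 : (n%:R - 2 : R) != 0.
  by rewrite gt_eqF// subr_gt0 ltr_nat (ltn_trans _ n3).
rewrite /avg ExZ; last exact: mom_psum.
rewrite /psum Ex_sum => [|t]; last exact: umom_mom mX.
under eq_bigr do rewrite hk.
rewrite sumr_const_nat -(mulr_natr k) mulrCA natrB; last by lia.
by rewrite -(natr1 n) (_ : n%:R + 1 - 3 = n%:R - 2); [rewrite mulVf// mulr1|ring].
Qed.

Lemma psum_telescope (f : int -> T -> R) n w : (2 <= n)%N ->
  psum (fun t w => f t w - f (t - 1) w) n w = f n%:Z w - f 2 w.
Proof.
elim: n => [//|n ih]; rewrite leq_eqVlt => /orP[/eqP <-|n2].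
  by rewrite psum_small// subrr.
rewrite psumS// ih// (_ : n.+1%:Z - 1 = n%:Z); last by lia.
by ring.
Qed.

(** Only two boundary values survive the summation, and division by n - 2 makes them of size 1/n. *)
Lemma Oedge_telescope (f : int -> T -> R) : umom P f ->
  Oedge P (avg (fun t w => f t w - f (t - 1) w)).
Proof.
move=> mf.
have h1 := Oedge_umom (fun n => n%:Z) inv_shift2_le mf.
have h2 := Oedge_umom (fun=> 2%:Z) inv_shift2_le mf.
apply: OrdE (OrdB h1 h2) => n w n3.
by rewrite /avg psum_telescope ?mulrBr//; lia.
Qed.

Let rho := phi1 / (1 - phi2).
Let kappa := (1 - phi2) * (1 + phi2) * (1 - rho ^+ 2).

Definition score_avg1 := avg (score1 z e).
Definition score_avg2 := avg (score2 z e).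
Definition noise_avg := avg (noise2 mu e).

(* First order parts, linear in the averaged scores, of the centred sample
   autocovariances at lags 0, 1, 2: the solution of the empirical Yule-Walker
   equations with the edge terms dropped. *)
Definition lin_acov0 n w :=
  kappa^-1 * (2 * rho * score_avg1 n w + 2 * phi2 * score_avg2 n w + noise_avg n w).
Definition lin_acov1 n w := rho * lin_acov0 n w + (1 - phi2)^-1 * score_avg1 n w.
Definition lin_acov2 n w := phi1 * lin_acov1 n w + phi2 * lin_acov0 n w + score_avg2 n w.

Lemma O1_score_avg1 : O1 P score_avg1. Proof. exact: avg_O1 (mds_score1 M). Qed.
Lemma O1_score_avg2 : O1 P score_avg2. Proof. exact: avg_O1 (mds_score2 M). Qed.
Lemma O1_noise_avg : O1 P noise_avg. Proof. exact: avg_O1 (mds_noise2 M). Qed.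

Lemma O1_lin_acov0 : O1 P lin_acov0.
Proof.
apply: OrdZ; apply: OrdD; last exact: O1_noise_avg.
by apply: OrdD; apply: OrdZ; [exact: O1_score_avg1|exact: O1_score_avg2].
Qed.

Lemma O1_lin_acov1 : O1 P lin_acov1.
Proof. by apply: OrdD; apply: OrdZ; [exact: O1_lin_acov0|exact: O1_score_avg1]. Qed.

Lemma O1_lin_acov2 : O1 P lin_acov2.
Proof.
apply: OrdD; last exact: O1_score_avg2.
by apply: OrdD; apply: OrdZ; [exact: O1_lin_acov1|exact: O1_lin_acov0].
Qed.

Let f1 (t : int) (w : T) : R := z t w * z (t - 1) w.
Let f0 (t : int) (w : T) : R := z t w * z t w.
Let f0' (t : int) (w : T) : R := z (t - 1) w * z (t - 1) w.

Let mf1 : umom P f1. Proof. exact: umomM (ar2_umom M) sz. Qed.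
Let mf0 : umom P f0. Proof. exact: umomM (ar2_umom M) (ar2_umom M). Qed.
Let mf0' : umom P f0'. Proof. exact: umomM sz sz. Qed.

(** These are the costs of shifting the summation window by one time unit, the only obstruction to
    exact empirical Yule-Walker equations. *)
Let r1 := avg (fun t w => f1 t w - f1 (t - 1) w).
Let r2 := avg (fun t w => f0 t w - f0 (t - 1) w).
Let r3 := avg (fun t w => f0' t w - f0' (t - 1) w).

Let Or1 : Oedge P r1. Proof. exact: Oedge_telescope. Qed.
Let Or2 : Oedge P r2. Proof. exact: Oedge_telescope. Qed.
Let Or3 : Oedge P r3. Proof. exact: Oedge_telescope. Qed.

Let a0 n w := burgG (path w) n - g0.
Let a1 n w := avg (fun t w => z (t - 1) w * z (t - 2) w) n w - g1.
Let a2 n w := burgE (path w) n - g2.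

Let avg_comb3 (X X1 X2 X3 : int -> T -> R) (c1 c2 c3 : R) n w :
  (forall t, X t w = c1 * X1 t w + c2 * X2 t w + c3 * X3 t w) ->
  avg X n w = c1 * avg X1 n w + c2 * avg X2 n w + c3 * avg X3 n w.
Proof.
move=> h; rewrite /avg !(mulrCA _ (n%:R - 2)^-1) -!mulrDr; congr (_ * _).
by rewrite /psum !mulr_sumr -!big_split/=; apply: eq_bigr => t _; rewrite h.
Qed.

Let avg_cst (k : R) n w : (3 < n)%N -> avg (fun _ _ => k) n w = k.
Proof.
move=> n3; rewrite /avg /psum sumr_const_nat -(mulr_natr k) mulrCA.
rewrite natrB; last by lia.
have n0 : (n%:R - 2 : R) != 0 by rewrite gt_eqF// subr_gt0 ltr_nat (ltn_trans _ n3).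
by rewrite -(natr1 n) (_ : n%:R + 1 - 3 = n%:R - 2); [rewrite mulVf// mulr1|ring].
Qed.

Let subn11 (t : int) : t - 1 - 1 = t - 2. Proof. by ring. Qed.

Let burgG_avg n w : burgG (path w) n = avg f0' n w.
Proof. by rewrite /burgG /avg /psum; congr (_ * _); apply: eq_bigr => t _; rewrite expr2. Qed.

Let burgE_avg n w : burgE (path w) n = avg (fun t w => z t w * z (t - 2) w) n w.
Proof. by []. Qed.

Let f1_avg n w : (3 < n)%N -> avg f1 n w = a1 n w + r1 n w + g1.
Proof.
move=> n3; rewrite /a1 /r1 (@avg_comb3 f1 (fun t w => z (t - 1) w * z (t - 2) w)
  (fun t w => f1 t w - f1 (t - 1) w) (fun _ _ => 0) 1 1 0 n w) => [|t]; first by ring.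
by rewrite /f1 subn11; ring.
Qed.

Let f0_avg n w : avg f0 n w = a0 n w + r2 n w + g0.
Proof.
rewrite /a0 /r2 burgG_avg (@avg_comb3 f0 f0'
  (fun t w => f0 t w - f0 (t - 1) w) (fun _ _ => 0) 1 1 0 n w) => [|t]; first by ring.
by rewrite /f0 /f0'; ring.
Qed.

Let f0''_avg n w : avg (fun t w => z (t - 2) w * z (t - 2) w) n w = a0 n w - r3 n w + g0.
Proof.
rewrite /a0 /r3 burgG_avg (@avg_comb3 _ f0'
  (fun t w => f0' t w - f0' (t - 1) w) (fun _ _ => 0) 1 (-1) 0 n w) => [|t]; first by ring.
by rewrite /f0' subn11; ring.
Qed.

Let rec t w : z t w = phi1 * z (t - 1) w + phi2 * z (t - 2) w + e t w.
Proof. by rewrite (ar2_innovE M); ring. Qed.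

(** The recursion times z_(t-1) is averaged and the population equation subtracted. [eq2] and [eq3]
    use the factors z_(t-2) and z_t; in the last, z_t e_t is expanded by the recursion once more. *)
Let eq1 n w : (3 < n)%N ->
  a1 n w + r1 n w = phi1 * a0 n w + phi2 * a1 n w + score_avg1 n w.
Proof.
move=> n3; apply: (addIr g1); rewrite -(f1_avg w n3).
rewrite (@avg_comb3 f1 f0' (fun t w => z (t - 1) w * z (t - 2) w) (score1 z e)
  phi1 phi2 1 n w) => [|t]; last first.
  by rewrite /f1 /f0' /score1 {1}rec; ring.
by rewrite [X in _ = _ + X](yule_walker1 M) /a0 burgG_avg /a1 /score_avg1; ring.
Qed.

Let eq2 n w : (3 < n)%N ->
  a2 n w = phi1 * a1 n w + phi2 * (a0 n w - r3 n w) + score_avg2 n w.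
Proof.
move=> n3; rewrite /a2 burgE_avg.
rewrite (@avg_comb3 _ (fun t w => z (t - 1) w * z (t - 2) w)
  (fun t w => z (t - 2) w * z (t - 2) w) (score2 z e) phi1 phi2 1 n w) => [|t]; last first.
  by rewrite /score2 {1}rec; ring.
by rewrite f0''_avg /a1 /score_avg2 (yule_walker2 M); ring.
Qed.

Let eq3 n w : (3 < n)%N -> a0 n w + r2 n w = phi1 * (a1 n w + r1 n w)
  + phi2 * a2 n w + phi1 * score_avg1 n w + phi2 * score_avg2 n w + noise_avg n w.
Proof.
move=> n3; apply: (addIr g0); rewrite -(f0_avg n w).
rewrite (@avg_comb3 f0 f1 (fun t w => z t w * z (t - 2) w)
  (fun t w => z t w * e t w) phi1 phi2 1 n w) => [|t]; last first.
  by rewrite /f0 /f1 {1}rec; ring.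
rewrite (f1_avg w n3) -burgE_avg.
rewrite (@avg_comb3 (fun t w => z t w * e t w) (score1 z e) (score2 z e)
  (fun t w => e t w * e t w) phi1 phi2 1 n w) => [|t]; last first.
  by rewrite /score1 /score2 {1}rec; ring.
rewrite (@avg_comb3 (fun t w => e t w * e t w) (noise2 mu e) (fun _ _ => mu 2)
  (fun _ _ => 0) 1 1 0 n w) => [|t]; last by rewrite /noise2; ring.
rewrite (avg_cst (mu 2) w n3) [X in _ = _ + X](yule_walker0 M).
by rewrite /a2 /score_avg1 /score_avg2 /noise_avg; ring.
Qed.

Let burgC_avg n w : burgC (path w) n =
  avg (fun t w => f0 t w + z (t - 2) w * z (t - 2) w) n w.
Proof.
by [].
Qed.

Let burgH_avg n w : burgH (path w) n =
  avg (fun t w => f1 t w + z (t - 1) w * z (t - 2) w) n w.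
Proof.
rewrite /burgH /avg /psum; congr (_ * _); apply: eq_bigr => t _.
by rewrite /f1 /path; ring.
Qed.

(** D and F run over one more index than [avg]; the correction is the term t = 2 and a rescaling,
    both divided by n - 1. *)
Let full_avg (X : int -> T -> R) n w : (3 < n)%N ->
  (n%:R - 1)^-1 * \sum_(2 <= t < n.+1) X t%:Z w
  = (n%:R - 1)^-1 * X 2 w + avg X n w - (n%:R - 1)^-1 * avg X n w.
Proof.
move=> n3; rewrite big_ltn; last by lia.
rewrite -/(psum X n w) /avg.
have h1 : (n%:R - 2 : R) != 0 by rewrite gt_eqF// subr_gt0 ltr_nat (ltn_trans _ n3).
have h2 : (n%:R - 1 : R) != 0 by rewrite gt_eqF// subr_gt0 ltr1n (ltn_trans _ n3).
by field; rewrite h1 h2.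
Qed.

Let EX2 t : Ex P (f0 t) = g0. Proof. exact: ar2_cov0 M t. Qed.
Let EX1 t : Ex P (f1 t) = g1. Proof. exact: ar2_cov1 M t. Qed.

(** Like the five means that follow, this one is exact at each n, so the first order parts of the
    errors contribute nothing to the bias, not even an edge term. *)
Lemma Ex_burgG n : (3 < n)%N -> Ex P (fun w => burgG (path w) n) = g0.
Proof.
move=> n3; rewrite -[RHS](Ex_avg n3 mf0' (fun t => EX2 (t - 1))).
by apply: eq_Ex => w; exact: burgG_avg.
Qed.

Lemma Ex_burgE n : (3 < n)%N -> Ex P (fun w => burgE (path w) n) = g2.
Proof.
move=> n3; rewrite -[RHS](Ex_avg n3 (umomM (ar2_umom M) sz2) (ar2_cov2 M)).
by apply: eq_Ex.
Qed.

Lemma Ex_burgC n : (3 < n)%N -> Ex P (fun w => burgC (path w) n) = 2 * g0.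
Proof.
move=> n3; transitivity (Ex P (avg (fun t w => f0 t w + z (t - 2) w * z (t - 2) w) n)).
  by apply: eq_Ex => w; exact: burgC_avg.
apply: Ex_avg => // [|t].
  by apply: umomD => //; exact: umomM sz2 sz2.
rewrite (ExD (umom_mom t mf0) (umom_mom t (umomM sz2 sz2))) EX2.
by rewrite (EX2 (t - 2)); ring.
Qed.

Lemma Ex_burgH n : (3 < n)%N -> Ex P (fun w => burgH (path w) n) = 2 * g1.
Proof.
move=> n3; transitivity (Ex P (avg (fun t w => f1 t w + z (t - 1) w * z (t - 2) w) n)).
  by apply: eq_Ex => w; exact: burgH_avg.
apply: Ex_avg => // [|t].
  by apply: umomD => //; exact: umomM sz sz2.
rewrite (ExD (umom_mom t mf1) (umom_mom t (umomM sz sz2))) EX1.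
by have := EX1 (t - 1); rewrite /f1 subn11 => ->; ring.
Qed.

Let Ex_full (X : int -> T -> R) (k : R) n : (3 < n)%N -> umom P X ->
  (forall t, Ex P (X t) = k) ->
  Ex P (fun w => (n%:R - 1)^-1 * \sum_(2 <= t < n.+1) X t%:Z w) = k.
Proof.
move=> n3 mX hk.
have mS : mom P (avg X n) by apply: momM; [exact: mom_cst|exact: mom_psum].
have m2 : mom P (X 2) by exact: umom_mom mX.
transitivity (Ex P (fun w => (n%:R - 1)^-1 * X 2 w + avg X n w
    - (n%:R - 1)^-1 * avg X n w)).
  by apply: eq_Ex => w; exact: full_avg.
rewrite ExB ?ExD; try by mom_tac.
rewrite (ExZ _ m2) (ExZ _ mS) hk (Ex_avg n3 mX hk); by ring.
Qed.

Lemma Ex_burgF n : (3 < n)%N -> Ex P (fun w => burgF (path w) n) = g1.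
Proof. by move=> n3; exact: (Ex_full n3 mf1 EX1). Qed.

Lemma Ex_burgD n : (3 < n)%N -> Ex P (fun w => burgD (path w) n) = 2 * g0.
Proof.
move=> n3; have h t : Ex P (fun w => f0 t w + f0' t w) = 2 * g0.
  rewrite (ExD (umom_mom t mf0) (umom_mom t mf0')) EX2.
  by rewrite (EX2 (t - 1)); ring.
rewrite -[RHS](Ex_full n3 (umomD mf0 mf0') h).
by apply: eq_Ex => w; rewrite /burgD; congr (_ * _); apply: eq_bigr => t _; rewrite !expr2.
Qed.

Hypotheses (hphi2 : `|phi2| < 1) (hrho : `|rho| < 1).

Let phi2m : 1 - phi2 != 0.
Proof. by move: hphi2; rewrite ltr_norml => /andP[? ?]; rewrite gt_eqF//; lra. Qed.

Let phi2p : 1 + phi2 != 0.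
Proof. by move: hphi2; rewrite ltr_norml => /andP[? ?]; rewrite gt_eqF//; lra. Qed.

Let rho2 : 1 - rho ^+ 2 != 0.
Proof.
rewrite gt_eqF// subr_gt0 -[rho ^+ 2]ger0_norm ?sqr_ge0// normrX.
by rewrite exprn_ilt1.
Qed.

Let phi1E : phi1 = rho * (1 - phi2). Proof. by rewrite /rho divfK. Qed.

Let solved n w (n3 : (3 < n)%N) :=
  linear_solve phi2m phi2p rho2 phi1E (eq1 w n3) (eq2 w n3) (eq3 w n3).

Let Oa0 : Oedge P (fun n w => a0 n w - lin_acov0 n w).
Proof.
have h := OrdZ kappa^-1 (OrdD (OrdD (OrdZ (- (2 * rho * phi2)) Or1)
  (OrdZ (- phi2 ^+ 2) Or3)) (OrdZ (-1) Or2)).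
apply: OrdE h => n w n3; have [-> _] := solved w n3.
by rewrite /lin_acov0 /kappa addrAC subrr add0r.
Qed.

Let Oa1 : Oedge P (fun n w => a1 n w - lin_acov1 n w).
Proof.
apply: OrdE (OrdD (OrdZ rho Oa0) (OrdZ (- (1 - phi2)^-1) Or1)) => n w n3.
by have [_ ->] := solved w n3; rewrite /lin_acov1; ring.
Qed.

Let Oa2 : Oedge P (fun n w => a2 n w - lin_acov2 n w).
Proof.
apply: OrdE (OrdD (OrdD (OrdZ phi1 Oa1) (OrdZ phi2 Oa0)) (OrdZ (- phi2) Or3)) => n w n3.
by rewrite (eq2 w n3) /lin_acov2; ring.
Qed.

Lemma burgG_edge : Oedge P (fun n w => (burgG (path w) n - g0) - lin_acov0 n w).
Proof. exact: Oa0. Qed.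

Lemma burgE_edge : Oedge P (fun n w => (burgE (path w) n - g2) - lin_acov2 n w).
Proof. exact: Oa2. Qed.

Lemma burgC_edge : Oedge P (fun n w => (burgC (path w) n - 2 * g0) - 2 * lin_acov0 n w).
Proof.
apply: OrdE (OrdD (OrdZ 2 Oa0) (OrdB Or2 Or3)) => n w n3.
rewrite burgC_avg (@avg_comb3 _ f0 (fun t w => z (t - 2) w * z (t - 2) w)
  (fun _ _ => 0) 1 1 0 n w) => [|t]; last by ring.
by rewrite f0_avg f0''_avg; ring.
Qed.

Lemma burgH_edge : Oedge P (fun n w => (burgH (path w) n - 2 * g1) - 2 * lin_acov1 n w).
Proof.
apply: OrdE (OrdD (OrdZ 2 Oa1) Or1) => n w n3.
rewrite burgH_avg (@avg_comb3 _ f1 (fun t w => z (t - 1) w * z (t - 2) w)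
  (fun _ _ => 0) 1 1 0 n w) => [|t]; last by ring.
by rewrite (f1_avg w n3) /a1; ring.
Qed.

Lemma burgF_edge : Oedge P (fun n w => (burgF (path w) n - g1) - lin_acov1 n w).
Proof.
have h1 : Oedge P (fun n w => (n%:R - 1)^-1 * (f1 2 w - g1)).
  apply: (Oedge_umom (f := fun t w => f1 t w - g1) (fun=> 2) inv_shift1_le).
  by apply: umomD => //; apply: umomN; exact: umom_cst.
have Oa1r1 : O1 P (fun n w => a1 n w + r1 n w).
  apply: OrdE (OrdD (OrdD (Oedge_O1 Oa1) O1_lin_acov1) (Oedge_O1 Or1)) => n w n3.
  by ring.
apply: OrdE (OrdB (OrdD h1 (OrdD Oa1 Or1)) (O1_scale inv_shift1_le Oa1r1)) => n w n3.
by rewrite /burgF (full_avg f1 w n3) (f1_avg w n3); ring.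
Qed.

Lemma burgD_edge : Oedge P (fun n w => (burgD (path w) n - 2 * g0) - 2 * lin_acov0 n w).
Proof.
pose X (t : int) (w : T) := f0 t w + f0' t w.
have h1 : Oedge P (fun n w => (n%:R - 1)^-1 * (X 2 w - 2 * g0)).
  apply: (Oedge_umom (f := fun t w => X t w - 2 * g0) (fun=> 2) inv_shift1_le).
  by apply: umomD; [exact: umomD|apply: umomN; exact: umom_cst].
have O1a : O1 P (fun n w => 2 * a0 n w + r2 n w).
  apply: OrdE (OrdD (OrdZ 2 (OrdD (Oedge_O1 Oa0) O1_lin_acov0)) (Oedge_O1 Or2)) => n w n3.
  by ring.
apply: OrdE (OrdB (OrdD h1 (OrdD (OrdZ 2 Oa0) Or2)) (O1_scale inv_shift1_le O1a)) => n w n3.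
have -> : burgD (path w) n = (n%:R - 1)^-1 * \sum_(2 <= t < n.+1) X t%:Z w.
  by rewrite /burgD; congr (_ * _); apply: eq_bigr => t _; rewrite !expr2.
rewrite (full_avg X w n3) (@avg_comb3 X f0 f0' (fun _ _ => 0) 1 1 0 n w) => [|t].
  by rewrite f0_avg -burgG_avg /a0; ring.
by rewrite /X; ring.
Qed.

(** The Levinson-Durbin product: each partial autocorrelation, rho and then phi2, multiplies the
    prediction variance by one minus its square. *)
Lemma model_variance : mu 2 = kappa * g0.
Proof.
have h1 : g1 = rho * g0.
  apply: (mulfI phi2m); rewrite mulrA [_ * rho]mulrC -phi1E.
  by rewrite mulrBl mul1r [X in X - _](yule_walker1 M); ring.
have := yule_walker0 M; rewrite (yule_walker2 M) h1 phi1E /kappa.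
by move: rho (mu 2) => p v h; lra.
Qed.

Lemma lag1_autocov : g1 = rho * g0.
Proof.
apply: (mulfI phi2m); rewrite mulrA [_ * rho]mulrC -phi1E.
by rewrite mulrBl mul1r [X in X - _](yule_walker1 M); ring.
Qed.

Lemma variance_gt0 : 0 < g0.
Proof.
have k0 : 0 < kappa.
  rewrite /kappa !mulr_gt0//.
  - by move: hphi2; rewrite ltr_norml => /andP[? ?]; lra.
  - by move: hphi2; rewrite ltr_norml => /andP[? ?]; lra.
  rewrite subr_gt0 -[rho ^+ 2]ger0_norm ?sqr_ge0// normrX exprn_ilt1//.
by have := ar2_innov_var M; rewrite model_variance pmulr_rgt0.
Qed.

End SampleMoments.

(** * Bias of the Burg estimators *)

Lemma measurable_inv (R : realType) : measurable_fun [set: R] (fun x : R => x^-1).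
Proof.
have -> : [set: R] = [set 0] `|` ~` [set 0] by rewrite setUv.
have m0 : measurable [set (0 : R)] by exact: measurable_set1.
apply/(measurable_funU _ m0 (measurableC m0)); split.
  exact: measurable_fun_set1.
apply: open_continuous_measurable_fun.
  exact/closed_openC/closed_eq.
by move=> x /[!inE]/= /eqP x0; exact: inv_continuous.
Qed.

Section ProductApproximation.
Context {d : measure_display} {T : measurableType d} {R : realType}.
Variable P : probability T R.
Implicit Types X Y : nat -> T -> R.

(** Swapping one factor at a time, as (X - X') Y + X' (Y - Y'), lets a second order product be
    replaced by the product of its linear parts. *)
Lemma O3_prod X Y X' Y' : O1 P Y -> O1 P X' ->
  O2 P (fun n w => X n w - X' n w) -> O2 P (fun n w => Y n w - Y' n w) ->
  O3 P (fun n w => X n w * Y n w - X' n w * Y' n w).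
Proof.
move=> hY hX' hX hYY.
apply: OrdE (OrdD (O21M hX hY) (O12M hX' hYY)) => n w _; ring.
Qed.

Lemma O3_ExB X Y : (forall n, (3 < n)%N -> mom P (X n)) ->
  (forall n, (3 < n)%N -> mom P (Y n)) ->
  O3 P (fun n w => X n w - Y n w) -> o3 (fun n => Ex P (X n) - Ex P (Y n)).
Proof.
move=> mX mY /O3_Ex; apply: o3E => n n3.
by rewrite -(ExB (mX n n3) (mY n n3)).
Qed.

End ProductApproximation.

Section BurgBias.
Context {d : measure_display} {T : measurableType d} {R : realType}.
Variables (P : probability T R) (phi1 phi2 : R) (mu : nat -> R) (g0 g1 g2 : R).
Variables (z : int -> {RV P >-> R}) (e : int -> T -> R).
Hypothesis M : ar2_model phi1 phi2 mu g0 g1 g2 z e.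

Let rho := phi1 / (1 - phi2).
Hypotheses (hphi2 : `|phi2| < 1) (hrho : `|rho| < 1).
Let kappa := (1 - phi2) * (1 + phi2) * (1 - rho ^+ 2).

Let path (w : T) (t : int) : R := z t w.

Let phi2m : 0 < 1 - phi2.
Proof. by move: hphi2; rewrite ltr_norml => /andP[? ?]; lra. Qed.

Let phi2p : 0 < 1 + phi2.
Proof. by move: hphi2; rewrite ltr_norml => /andP[? ?]; lra. Qed.

Let rho2 : 0 < 1 - rho ^+ 2.
Proof. by rewrite subr_gt0 -norm2 exprn_ilt1. Qed.

Let phi1E : phi1 = rho * (1 - phi2). Proof. by rewrite /rho divfK// gt_eqF. Qed.
Let g1E : g1 = rho * g0. Proof. exact: (lag1_autocov M hphi2). Qed.
Let g2E : g2 = phi1 * g1 + phi2 * g0. Proof. exact: (yule_walker2 M). Qed.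
Let vE : mu 2 = kappa * g0. Proof. exact: (model_variance M hphi2). Qed.
Let g0_gt0 : 0 < g0. Proof. exact: (variance_gt0 M hphi2 hrho). Qed.

Let U1 := avg (score1 z e).
Let U2 := avg (score2 z e).
Let V := avg (noise2 mu e).
Let S0 := lin_acov0 phi1 phi2 mu z e.
Let S1 := lin_acov1 phi1 phi2 mu z e.
Let S2 := lin_acov2 phi1 phi2 mu z e.

Let O1_U1 : O1 P U1. Proof. exact: (O1_score_avg1 M). Qed.
Let O1_U2 : O1 P U2. Proof. exact: (O1_score_avg2 M). Qed.
Let O1_V : O1 P V. Proof. exact: (O1_noise_avg M). Qed.
Let O1_S0 : O1 P S0. Proof. exact: (O1_lin_acov0 M). Qed.
Let O1_S1 : O1 P S1. Proof. exact: (O1_lin_acov1 M). Qed.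
Let O1_S2 : O1 P S2. Proof. exact: (O1_lin_acov2 M). Qed.

Let cC n w := burgC (path w) n - 2 * g0.
Let cD n w := burgD (path w) n - 2 * g0.
Let cE n w := burgE (path w) n - g2.
Let cF n w := burgF (path w) n - g1.
Let cG n w := burgG (path w) n - g0.
Let cH n w := burgH (path w) n - 2 * g1.

Let eC : Oedge P (fun n w => cC n w - 2 * S0 n w). Proof. exact: (burgC_edge M). Qed.
Let eD : Oedge P (fun n w => cD n w - 2 * S0 n w). Proof. exact: (burgD_edge M). Qed.
Let eE : Oedge P (fun n w => cE n w - S2 n w). Proof. exact: (burgE_edge M). Qed.
Let eF : Oedge P (fun n w => cF n w - S1 n w). Proof. exact: (burgF_edge M). Qed.
Let eG : Oedge P (fun n w => cG n w - S0 n w). Proof. exact: (burgG_edge M). Qed.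
Let eH : Oedge P (fun n w => cH n w - 2 * S1 n w). Proof. exact: (burgH_edge M). Qed.

Let O1_edge X S : O1 P S -> Oedge P (fun n w => X n w - S n w) -> O1 P X.
Proof.
by move=> hS /Oedge_O1 h; apply: OrdE (OrdD h hS) => n w _; rewrite subrK.
Qed.

Let O1_cC : O1 P cC. Proof. exact: O1_edge (OrdZ 2 O1_S0) eC. Qed.
Let O1_cD : O1 P cD. Proof. exact: O1_edge (OrdZ 2 O1_S0) eD. Qed.
Let O1_cE : O1 P cE. Proof. exact: O1_edge O1_S2 eE. Qed.
Let O1_cF : O1 P cF. Proof. exact: O1_edge O1_S1 eF. Qed.
Let O1_cG : O1 P cG. Proof. exact: O1_edge O1_S0 eG. Qed.
Let O1_cH : O1 P cH. Proof. exact: O1_edge (OrdZ 2 O1_S1) eH. Qed.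

Let mom_burg (X : nat -> T -> R) k n : O1 P (fun n w => X n w - k) -> (3 < n)%N ->
  mom P (X n).
Proof.
move=> hX n3; rewrite (_ : X n = fun w => (X n w - k) + k).
  by apply: momD; [exact: Ord_mom hX n3|exact: mom_cst].
by apply/funext => w; rewrite subrK.
Qed.

Let refl n w := burg_refl (path w) n.
Let ph n w := burg_phi2 (path w) n.

Let mom_refl n : (3 < n)%N -> mom P (refl n).
Proof.
move=> n3; apply: (@mom_bounded _ _ _ _ _ 1); last first.
  by move=> w; exact: burg_refl_le1.
apply: measurable_funM.
  by apply: measurable_funM => //; exact: mom_measurable (mom_burg O1_cF n3).
apply: measurableT_comp; first exact: measurable_inv.
exact: mom_measurable (mom_burg O1_cD n3).
Qed.

Let mom_ph n : (3 < n)%N -> mom P (ph n).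
Proof.
move=> n3; apply: (@mom_bounded _ _ _ _ _ 1); last first.
  by move=> w; exact: burg_phi2_le1.
have mC := mom_burg O1_cC n3; have mD := mom_burg O1_cD n3.
have mE := mom_burg O1_cE n3; have mF := mom_burg O1_cF n3.
have mG := mom_burg O1_cG n3; have mH := mom_burg O1_cH n3.
apply: measurable_funB => //; apply: measurable_funM.
  apply: (@mom_measurable _ _ _ P).
  by mom_tac.
apply: measurableT_comp; first exact: measurable_inv.
apply: (@mom_measurable _ _ _ P).
by mom_tac.
Qed.

Lemma mom_burg_phi2 n : (3 < n)%N -> mom P (fun w => burg_phi2 (fun t => z t w) n).
Proof. exact: mom_ph. Qed.

Lemma mom_burg_phi1 n : (3 < n)%N -> mom P (fun w => burg_phi1 (fun t => z t w) n).
Proof.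
move=> n3; apply: momM; first exact: mom_refl.
by apply: momD; [exact: mom_cst|apply: momN; exact: mom_ph].
Qed.

(** * Expansion and mean of the first reflection coefficient *)

Let dl n w := refl n w - rho.
Let tau n w := ph n w - phi2.

Let mom_dl n : (3 < n)%N -> mom P (dl n).
Proof. by move=> /mom_refl h; rewrite /dl; mom_tac. Qed.

Let mom_tau n : (3 < n)%N -> mom P (tau n).
Proof. by move=> /mom_ph h; rewrite /tau; mom_tac. Qed.

Let dl_bound n w : (3 < n)%N -> `|dl n w| <= 2.
Proof.
move=> n3; apply: (le_trans (ler_normB _ _)).
rewrite -[leRHS]/(1 + 1); apply: lerD; last exact: ltW.
exact: burg_refl_le1.
Qed.

Let tau_bound n w : (3 < n)%N -> `|tau n w| <= 2.
Proof.
move=> n3; apply: (le_trans (ler_normB _ _)).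
rewrite -[leRHS]/(1 + 1); apply: lerD; last exact: ltW.
exact: burg_phi2_le1.
Qed.

(** [mm] is S1 - rho S0, so [mm / g0] is the linear part of [dl]; [nu] is its counterpart in the
    statistics themselves, close to 2 [mm]. *)
Let mm n w := (1 - phi2)^-1 * U1 n w.
Let nu n w := 2 * cF n w - rho * cD n w.

Let O1_mm : O1 P mm. Proof. exact: OrdZ. Qed.
Let O1_nu : O1 P nu. Proof. by apply: OrdB; exact: OrdZ. Qed.

Let S1E n w : S1 n w = rho * S0 n w + mm n w. Proof. by []. Qed.

(** From dl D = nu with D split as 2 g0 + cD. Only the constant is divided out, so [dl] stays on the
    right and D may be arbitrarily small. *)
Let dl_eq n w : (3 < n)%N ->
  dl n w = (2 * g0)^-1 * nu n w - (2 * g0)^-1 * (dl n w * cD n w).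
Proof.
move=> n3; have := burg_refl_mul (path w) n3 => h.
have -> : nu n w = dl n w * (2 * g0 + cD n w).
  have -> : nu n w = 2 * burgF (path w) n - rho * burgD (path w) n.
    by rewrite /nu /cF /cD g1E; ring.
  by rewrite -h /dl /refl /cD; ring.
by field; rewrite gt_eqF.
Qed.

Let O1_dlM X : O1 P X -> O1 P (fun n w => dl n w * X n w).
Proof. exact: (Ord_bounded mom_dl dl_bound). Qed.

Let O1_tauM X : O1 P X -> O1 P (fun n w => tau n w * X n w).
Proof. exact: (Ord_bounded mom_tau tau_bound). Qed.

Let O1_dl : O1 P dl.
Proof.
apply: OrdE (OrdB (OrdZ _ O1_nu) (OrdZ _ (O1_dlM O1_cD))) => n w n3.
exact: dl_eq.
Qed.

Let O2_dl : O2 P (fun n w => dl n w - g0^-1 * mm n w).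
Proof.
have h1 : Oedge P (fun n w => nu n w - 2 * mm n w).
  apply: OrdE (OrdB (OrdZ 2 eF) (OrdZ rho eD)) => n w _.
  by rewrite S1E /nu; ring.
apply: OrdE (OrdB (OrdZ (2 * g0)^-1 (Oedge_O2 h1)) (OrdZ (2 * g0)^-1
  (O1M O1_dl O1_cD))) => n w n3.
by rewrite {1}(dl_eq w n3); field; rewrite gt_eqF.
Qed.

Let momP X n : O1 P X -> (3 < n)%N -> mom P (X n).
Proof. exact: Ord_mom. Qed.

Let Ex_centered (X : nat -> T -> R) k n : (3 < n)%N ->
  O1 P (fun n w => X n w - k) -> Ex P (X n) = k -> Ex P (fun w => X n w - k) = 0.
Proof.
move=> n3 hX hk; rewrite ExB ?Ex_cst ?hk ?subrr//.
- exact: mom_burg hX n3.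
- exact: mom_cst.
Qed.

Let Ex_cC n (n3 : (3 < n)%N) : Ex P (cC n) = 0.
Proof. exact: (@Ex_centered (fun n w => burgC (path w) n) (2 * g0) n n3 O1_cC (Ex_burgC M n3)). Qed.
Let Ex_cD n (n3 : (3 < n)%N) : Ex P (cD n) = 0.
Proof. exact: (@Ex_centered (fun n w => burgD (path w) n) (2 * g0) n n3 O1_cD (Ex_burgD M n3)). Qed.
Let Ex_cE n (n3 : (3 < n)%N) : Ex P (cE n) = 0.
Proof. exact: (@Ex_centered (fun n w => burgE (path w) n) g2 n n3 O1_cE (Ex_burgE M n3)). Qed.
Let Ex_cF n (n3 : (3 < n)%N) : Ex P (cF n) = 0.
Proof. exact: (@Ex_centered (fun n w => burgF (path w) n) g1 n n3 O1_cF (Ex_burgF M n3)). Qed.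
Let Ex_cG n (n3 : (3 < n)%N) : Ex P (cG n) = 0.
Proof. exact: (@Ex_centered (fun n w => burgG (path w) n) g0 n n3 O1_cG (Ex_burgG M n3)). Qed.
Let Ex_cH n (n3 : (3 < n)%N) : Ex P (cH n) = 0.
Proof. exact: (@Ex_centered (fun n w => burgH (path w) n) (2 * g1) n n3 O1_cH (Ex_burgH M n3)). Qed.

Let O3_mom X Y n : O1 P X -> O1 P Y -> (3 < n)%N -> mom P (fun w => X n w * Y n w).
Proof. by move=> hX hY n3; apply: momM; exact: momP. Qed.

Let Ex_dl : o3 (fun n => Ex P (dl n) + g0 ^- 2 * Ex P (fun w => mm n w * S0 n w)).
Proof.
have h : o3 (fun n => Ex P (fun w => dl n w * cD n w)
    - Ex P (fun w => (g0^-1 * mm n w) * (2 * S0 n w))).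
  apply: O3_ExB => [n n3|n n3|].
  - exact: O3_mom.
  - by apply: momM; apply: momM; [exact: mom_cst|exact: momP|exact: mom_cst|exact: momP].
  - exact: (O3_prod O1_cD (OrdZ _ O1_mm) O2_dl (Oedge_O2 eD)).
apply: o3E (o3Z (- (2 * g0)^-1) h) => n n3.
have mnu := momP O1_nu n3; have mdl := momP O1_dl n3; have mcD := momP O1_cD n3.
have mmm := momP O1_mm n3; have mS := momP O1_S0 n3; have mcF := momP O1_cF n3.
(* [nu] is not linearised here: its edge part is of the order of the bias, while in the statistics
   its mean vanishes exactly. *)
have Enu : Ex P (nu n) = 0.
  rewrite /nu ExB ?ExZ ?Ex_cF ?Ex_cD//; try by mom_tac.
  by ring.
have -> : Ex P (dl n) = - (2 * g0)^-1 * Ex P (fun w => dl n w * cD n w).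
  transitivity (Ex P (fun w => (2 * g0)^-1 * nu n w - (2 * g0)^-1 * (dl n w * cD n w))).
    by apply: eq_Ex => w; exact: dl_eq.
  rewrite ExB ?ExZ; try by mom_tac.
  by rewrite (_ : Ex P (fun w => nu n w) = 0)//; ring.
have -> : Ex P (fun w => (g0^-1 * mm n w) * (2 * S0 n w))
    = 2 * g0^-1 * Ex P (fun w => mm n w * S0 n w).
  rewrite -ExZ; last by mom_tac.
  by apply: eq_Ex => w; ring.
by field; rewrite gt_eqF.
Qed.

(** * Expansion and mean of the estimator of phi2 *)

Let q0 := 2 * g0 * (1 - rho ^+ 2).
Let q0_gt0 : 0 < q0. Proof. by rewrite /q0 mulr_gt0// mulr_gt0. Qed.

(** N - phi2 Q equals 2 E - phi2 C + (1 - phi2)(2 r^2 G - 2 r H). Its term linear in r - rho alone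
    has coefficient proportional to rho g0 - g1 = 0, so [dl] enters only through the second order
    part [w2], which Q shares. *)
Let l1 n w := 2 * cE n w - phi2 * cC n w - 2 * phi1 * cH n w + 2 * rho * phi1 * cG n w.
Let w2 n w := - (2 * (dl n w * cH n w)) + 4 * rho * (dl n w * cG n w)
  + 2 * g0 * (dl n w * dl n w) + 2 * (dl n w * (dl n w * cG n w)).
Let qlin n w := cC n w - 2 * rho * cH n w + 2 * rho ^+ 2 * cG n w.
Let q n w := qlin n w + w2 n w.
Let L n w := l1 n w + (1 - phi2) * w2 n w.
(** [l] and [q1] are the linear parts of [l1] and [q]. The Yule-Walker structure removes S0, hence
    V, from [l]. *)
Let l n w := 2 * U2 n w - 2 * rho * U1 n w.
Let q1 n w := 2 * (1 - rho ^+ 2) * S0 n w - 4 * rho * mm n w.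

Let burgQ_eq n w : burg_Q (path w) n = q0 + q n w.
Proof.
rewrite /q /w2 /qlin /q0 /cC /cH /cG /dl /burg_Q -/(refl n w) g1E.
by ring.
Qed.

Let burgN_eq n w : burg_N (path w) n = phi2 * burg_Q (path w) n + L n w.
Proof.
rewrite /L /l1 /w2 /cE /cC /cH /cG /dl /burg_Q /burg_N -/(refl n w) g2E g1E phi1E.
by ring.
Qed.

Let tau_eq n w : (3 < n)%N ->
  tau n w = q0^-1 * L n w - q0^-1 * (tau n w * q n w).
Proof.
move=> n3; have h : tau n w * (q0 + q n w) = L n w.
  by rewrite -burgQ_eq /tau mulrBl (burg_phi2_mul (path w) n3) burgN_eq addrC addKr.
by rewrite -h; field; rewrite gt_eqF.
Qed.

Let O1_w2 : O1 P w2.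
Proof.
apply: OrdD; last by apply: OrdZ; do 2 apply: O1_dlM.
apply: OrdD; last by apply: OrdZ; exact: O1_dlM.
apply: OrdD; last by apply: OrdZ; exact: O1_dlM.
by apply: OrdN; apply: OrdZ; exact: O1_dlM.
Qed.

Let O2_w2 : O2 P w2.
Proof.
apply: OrdD; last by apply: OrdZ; apply: O1M => //; exact: O1_dlM.
apply: OrdD; last by apply: OrdZ; exact: O1M.
apply: OrdD; last by apply: OrdZ; exact: O1M.
by apply: OrdN; apply: OrdZ; exact: O1M.
Qed.

Let O1_l1 : O1 P l1.
Proof.
apply: OrdD; last exact: OrdZ.
by apply: OrdB; [apply: OrdB|]; exact: OrdZ.
Qed.

Let O1_qlin : O1 P qlin.
Proof.
apply: OrdD; last exact: OrdZ.
by apply: OrdB => //; exact: OrdZ.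
Qed.

Let O1_q : O1 P q. Proof. exact: OrdD. Qed.
Let O1_L : O1 P L. Proof. by apply: OrdD => //; exact: OrdZ. Qed.
Let O1_l : O1 P l. Proof. by apply: OrdB; exact: OrdZ. Qed.
Let O1_q1 : O1 P q1. Proof. by apply: OrdB; exact: OrdZ. Qed.

Let O1_tau : O1 P tau.
Proof.
apply: OrdE (OrdB (OrdZ _ O1_L) (OrdZ _ (O1_tauM O1_q))) => n w n3.
exact: tau_eq.
Qed.

Let Oedge_l1 : Oedge P (fun n w => l1 n w - l n w).
Proof.
apply: OrdE (OrdD (OrdB (OrdB (OrdZ 2 eE) (OrdZ phi2 eC)) (OrdZ (2 * phi1) eH))
  (OrdZ (2 * rho * phi1) eG)) => n w _.
have S2E : S2 n w = phi1 * S1 n w + phi2 * S0 n w + U2 n w by [].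
have U1E : U1 n w = (1 - phi2) * mm n w by rewrite /mm mulVKf// gt_eqF.
by rewrite S2E S1E /l1 /l U1E phi1E; ring.
Qed.

Let O2_q : O2 P (fun n w => q n w - q1 n w).
Proof.
apply: OrdE (OrdD (OrdD (OrdB (Oedge_O2 eC) (OrdZ (2 * rho) (Oedge_O2 eH)))
  (OrdZ (2 * rho ^+ 2) (Oedge_O2 eG))) O2_w2) => n w _.
by rewrite S1E /q /qlin /q1; ring.
Qed.

Let O2_tau : O2 P (fun n w => tau n w - q0^-1 * l n w).
Proof.
apply: OrdE (OrdB (OrdD (OrdZ q0^-1 (Oedge_O2 Oedge_l1))
  (OrdZ (q0^-1 * (1 - phi2)) O2_w2)) (OrdZ q0^-1 (O1M O1_tau O1_q))) => n w n3.
by rewrite {1}(tau_eq w n3) /L; ring.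
Qed.

(** With [dl] close to mm/g0, the terms in H and G combine to -4 mm^2/g0 and the square gives 2
    mm^2/g0; the cubic term is negligible. *)
Let O3_w2 : O3 P (fun n w => w2 n w - - (2 / g0) * (mm n w * mm n w)).
Proof.
have O1_m' : O1 P (fun n w => g0^-1 * mm n w) by exact: OrdZ.
have hH : O3 P (fun n w => dl n w * cH n w - (g0^-1 * mm n w) * (2 * S1 n w)).
  exact: (O3_prod O1_cH O1_m' O2_dl (Oedge_O2 eH)).
have hG : O3 P (fun n w => dl n w * cG n w - (g0^-1 * mm n w) * S0 n w).
  exact: (O3_prod O1_cG O1_m' O2_dl (Oedge_O2 eG)).
have hd : O3 P (fun n w => dl n w * dl n w - (g0^-1 * mm n w) * (g0^-1 * mm n w)).
  exact: (O3_prod O1_dl O1_m' O2_dl O2_dl).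
have h3 : O3 P (fun n w => dl n w * (dl n w * cG n w)).
  by apply: O12M => //; exact: O1M.
apply: OrdE (OrdD (OrdD (OrdD (OrdN (OrdZ 2 hH)) (OrdZ (4 * rho) hG))
  (OrdZ (2 * g0) hd)) (OrdZ 2 h3)) => n w _.
by rewrite S1E /w2; field; rewrite gt_eqF.
Qed.

Let Ex_tau : o3 (fun n => Ex P (tau n)
  - q0^-1 * ((1 - phi2) * (- (2 / g0) * Ex P (fun w => mm n w * mm n w))
             - q0^-1 * Ex P (fun w => l n w * q1 n w))).
Proof.
have h1 : o3 (fun n => Ex P (w2 n) - Ex P (fun w => - (2 / g0) * (mm n w * mm n w))).
  apply: O3_ExB => // n n3; first exact: momP.
  by apply: momM; [exact: mom_cst|exact: O3_mom].
have h2 : o3 (fun n => Ex P (fun w => tau n w * q n w)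
    - Ex P (fun w => (q0^-1 * l n w) * q1 n w)).
  apply: O3_ExB => [n n3|n n3|].
  - exact: O3_mom.
  - by apply: momM; [apply: momM; [exact: mom_cst|exact: momP]|exact: momP].
  - exact: (O3_prod O1_q (OrdZ _ O1_l) O2_tau O2_q).
apply: o3E (o3Z q0^-1 (o3B (o3Z (1 - phi2) h1) h2)) => n n3.
have mw := momP O1_w2 n3; have mt := momP O1_tau n3; have mq := momP O1_q n3.
have mC := momP O1_cC n3; have mE := momP O1_cE n3.
have mG := momP O1_cG n3; have mH := momP O1_cH n3.
have ml1 := momP O1_l1 n3; have ml := momP O1_l n3; have mq1 := momP O1_q1 n3.
have mmm := momP O1_mm n3.
have El1 : Ex P (l1 n) = 0.
  rewrite /l1 ExD; try by mom_tac.
  rewrite ExB; try by mom_tac.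
  rewrite ExB; try by mom_tac.
  rewrite !ExZ ?Ex_cE ?Ex_cC ?Ex_cH ?Ex_cG//; try by mom_tac.
  by ring.
have -> : Ex P (tau n) = q0^-1 * ((1 - phi2) * Ex P (w2 n)
    - Ex P (fun w => tau n w * q n w)).
  transitivity (Ex P (fun w => q0^-1 * (l1 n w + ((1 - phi2) * w2 n w
      - tau n w * q n w)))).
    by apply: eq_Ex => w; rewrite {1}(tau_eq w n3) /L; ring.
  rewrite ExZ; last by mom_tac.
  rewrite ExD; try by mom_tac.
  rewrite (_ : Ex P (fun w => l1 n w) = 0)// add0r ExB; try by mom_tac.
  by rewrite ExZ; last by mom_tac.
have -> : Ex P (fun w => (q0^-1 * l n w) * q1 n w)
    = q0^-1 * Ex P (fun w => l n w * q1 n w).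
  rewrite -ExZ; last by mom_tac.
  by apply: eq_Ex => w; ring.
rewrite ExZ; last by mom_tac.
by ring.
Qed.

Let Ex_dltau : o3 (fun n => Ex P (fun w => dl n w * tau n w)
  - g0^-1 * q0^-1 * Ex P (fun w => mm n w * l n w)).
Proof.
have h : o3 (fun n => Ex P (fun w => dl n w * tau n w)
    - Ex P (fun w => (g0^-1 * mm n w) * (q0^-1 * l n w))).
  apply: O3_ExB => [n n3|n n3|].
  - exact: O3_mom.
  - by apply: momM; apply: momM; [exact: mom_cst|exact: momP|exact: mom_cst|exact: momP].
  - exact: (O3_prod O1_tau (OrdZ _ O1_mm) O2_dl O2_tau).
apply: o3E h => n n3; congr (_ - _).
rewrite -ExZ; last exact: O3_mom.
by apply: eq_Ex => w; ring.
Qed.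

(** * Exact second moments of the linear parts and assembly of the bias *)

Let io n : R := (n%:R - 2)^-1.

Let Ex_U11 n (n3 : (3 < n)%N) : Ex P (fun w => U1 n w * U1 n w) = kappa * g0 ^+ 2 * io n.
Proof.
rewrite (Ex_avgM n3 (mds_score1 M) (mds_score1 M) (Ex_score11 M)) vE /io; ring.
Qed.
Let Ex_U22 n (n3 : (3 < n)%N) : Ex P (fun w => U2 n w * U2 n w) = kappa * g0 ^+ 2 * io n.
Proof.
rewrite (Ex_avgM n3 (mds_score2 M) (mds_score2 M) (Ex_score22 M)) vE /io; ring.
Qed.
Let Ex_U12 n (n3 : (3 < n)%N) :
  Ex P (fun w => U1 n w * U2 n w) = rho * kappa * g0 ^+ 2 * io n.
Proof.
rewrite (Ex_avgM n3 (mds_score1 M) (mds_score2 M) (Ex_score12 M)) vE g1E /io; ring.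
Qed.
Let Ex_U1V n (n3 : (3 < n)%N) : Ex P (fun w => U1 n w * V n w) = 0.
Proof.
by rewrite (Ex_avgM n3 (mds_score1 M) (mds_noise2 M) (Ex_score1_noise2 M)) mul0r.
Qed.
Let Ex_U2V n (n3 : (3 < n)%N) : Ex P (fun w => U2 n w * V n w) = 0.
Proof.
by rewrite (Ex_avgM n3 (mds_score2 M) (mds_noise2 M) (Ex_score2_noise2 M)) mul0r.
Qed.

(** V is allowed in one factor only; being orthogonal to U1 and U2, it leaves no trace in the
    value. *)
Let Ex_bil (a b a' b' c' : R) n (n3 : (3 < n)%N) :
  Ex P (fun w => (a * U1 n w + b * U2 n w) * (a' * U1 n w + b' * U2 n w + c' * V n w))
  = (a * a' + b * b' + rho * (a * b' + b * a')) * (kappa * g0 ^+ 2 * io n).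
Proof.
have m1 := momP O1_U1 n3; have m2 := momP O1_U2 n3; have mV := momP O1_V n3.
transitivity (Ex P (fun w => a * a' * (U1 n w * U1 n w)
  + (b * b' * (U2 n w * U2 n w) + ((a * b' + b * a') * (U1 n w * U2 n w)
  + (a * c' * (U1 n w * V n w) + b * c' * (U2 n w * V n w)))))).
  by apply: eq_Ex => w; ring.
do 4 (rewrite ExD; try by mom_tac).
rewrite !ExZ; try by mom_tac.
rewrite (Ex_U11 n3) (Ex_U12 n3) (Ex_U22 n3) (Ex_U1V n3) (Ex_U2V n3); ring.
Qed.

Let kappa_neq0 : kappa != 0.
Proof. by rewrite /kappa !mulf_neq0// gt_eqF. Qed.

Let S0E n w : S0 n w = kappa^-1 * (2 * rho * U1 n w + 2 * phi2 * U2 n w + V n w).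
Proof. by []. Qed.

Let Ex_mmS0 n (n3 : (3 < n)%N) : Ex P (fun w => mm n w * S0 n w)
  = 2 * rho * (1 + phi2) / (1 - phi2) * g0 ^+ 2 * io n.
Proof.
have := Ex_bil (1 - phi2)^-1 0 (kappa^-1 * (2 * rho)) (kappa^-1 * (2 * phi2)) kappa^-1 n3.
rewrite (_ : Ex P _ = Ex P (fun w => mm n w * S0 n w)) => [->|].
  by field; rewrite kappa_neq0 gt_eqF.
by apply: eq_Ex => w; rewrite S0E /mm; ring.
Qed.

Let Ex_mmmm n (n3 : (3 < n)%N) : Ex P (fun w => mm n w * mm n w)
  = (1 + phi2) / (1 - phi2) * (1 - rho ^+ 2) * g0 ^+ 2 * io n.
Proof.
have := Ex_bil (1 - phi2)^-1 0 (1 - phi2)^-1 0 0 n3.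
rewrite (_ : Ex P _ = Ex P (fun w => mm n w * mm n w)) => [->|].
  by rewrite /kappa; field; rewrite gt_eqF.
by apply: eq_Ex => w; rewrite /mm; ring.
Qed.

(** [l] is twice the residual of U2 after projection on U1, because E(U1 U2) = rho E(U1^2), while
    [mm] is a multiple of U1. *)
Let Ex_mml n (n3 : (3 < n)%N) : Ex P (fun w => mm n w * l n w) = 0.
Proof.
have := Ex_bil (1 - phi2)^-1 0 (- (2 * rho)) 2 0 n3.
rewrite (_ : Ex P _ = Ex P (fun w => mm n w * l n w)) => [->|].
  by ring.
by apply: eq_Ex => w; rewrite /mm /l; ring.
Qed.

Let Ex_lq1 n (n3 : (3 < n)%N) : Ex P (fun w => l n w * q1 n w)
  = 8 * phi2 * (1 - rho ^+ 2) ^+ 2 * g0 ^+ 2 * io n.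
Proof.
pose A := 2 * (1 - rho ^+ 2) / kappa.
have := Ex_bil (- (2 * rho)) 2 (A * (2 * rho) - 4 * rho / (1 - phi2)) (A * (2 * phi2)) A n3.
rewrite (_ : Ex P _ = Ex P (fun w => l n w * q1 n w)) => [->|].
  by rewrite /A; field; rewrite kappa_neq0 gt_eqF.
by apply: eq_Ex => w; rewrite /q1 S0E /l /mm /A; field; rewrite kappa_neq0 gt_eqF.
Qed.

(** The quadratic term [w2] contributes -(1 + phi2)/n, and the correlation of [l] with the
    denominator fluctuation [q1] contributes -2 phi2/n. *)
Lemma burg_phi2_bias : o3 (fun n =>
  Ex P (fun w => burg_phi2 (fun t => z t w) n - phi2) + (1 + 3 * phi2) / n%:R).
Proof.
apply: o3E (o3B Ex_tau (o3Z (1 + 3 * phi2) (@o3_shift R))) => n n3.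
rewrite (Ex_mmmm n3) (Ex_lq1 n3) -/(tau n) -/(io n) /q0.
move: (n%:R^-1 : R) => N.
by field; rewrite !gt_eqF.
Qed.

(** The mean of [dl] gives -2 rho (1 + phi2)/n and that of [tau] gives rho (1 + 3 phi2)/n; the sum
    is -rho (1 - phi2)/n = -phi1/n. *)
Lemma burg_phi1_bias : o3 (fun n =>
  Ex P (fun w => burg_phi1 (fun t => z t w) n - phi1) + phi1 / n%:R).
Proof.
have h := o3D (o3B (o3B (o3Z (1 - phi2) Ex_dl) (o3Z rho burg_phi2_bias)) Ex_dltau)
  (o3Z (- (2 * rho * (1 + phi2))) (@o3_shift R)).
apply: o3E h => n n3.
have md := mom_dl n3; have mt := mom_tau n3.
(* An exact expansion of r (1 - p) - rho (1 - phi2) around (rho, phi2), with no remainder. *)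
have -> : Ex P (fun w => burg_phi1 (fun t => z t w) n - phi1)
    = (1 - phi2) * Ex P (dl n) - rho * Ex P (tau n) - Ex P (fun w => dl n w * tau n w).
  transitivity (Ex P (fun w => (1 - phi2) * dl n w - rho * tau n w - dl n w * tau n w)).
    by apply: eq_Ex => w; rewrite /burg_phi1 -/(burg_refl _ _) /dl /tau /refl /ph phi1E; ring.
  rewrite ExB; try by mom_tac.
  rewrite ExB; try by mom_tac.
  by rewrite !ExZ; try by mom_tac.
rewrite (Ex_mmS0 n3) (Ex_mml n3) -/(tau n) -/(io n).
rewrite phi1E.
move: (n%:R^-1 : R) => N.
by field; rewrite !gt_eqF.
Qed.

End BurgBias.

(** * From the n^(-3/2) remainder to the stated expansions *)

Lemma o3_littleo (R : realType) (u : nat -> R) :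
  o3 u -> u =o_\oo (fun n : nat => n%:R^-1 : R).
Proof.
move=> [K hK]; apply/eqoP => eps eps0.
near=> n.
have n3 : (3 < n)%N by near: n; exists 4%N.
have N0 : (0 : R) < n%:R by rewrite ltr0n (ltn_trans _ n3).
have s0 : 0 < Num.sqrt (n%:R : R) by rewrite sqrtr_gt0.
apply: (le_trans (hK n n3)).
rewrite (ger0_norm (_ : 0 <= n%:R^-1)); last by rewrite invr_ge0 ltW.
rewrite /rate32 invfM mulrCA mulrC ler_wpM2r ?invr_ge0 ?(ltW N0)//.
rewrite ler_pdivrMr// -ler_pdivrMl//.
have : (eps^-1 * K) ^+ 2 <= n%:R.
  by near: n; exact: nbhs_infty_ger.
by move=> h; rewrite (le_trans (ler_norm _))// -sqrtr_sqr ler_wsqrtr.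
Unshelve. all: by end_near.
Qed.

Lemma bias_expansion (R : realType) (d : measure_display) (T : measurableType d)
    (P : probability T R) (X : nat -> T -> R) (c : R) :
  (forall n, (3 < n)%N -> mom P (X n)) ->
  o3 (fun n => Ex P (X n) + c / n%:R) ->
  exists r : nat -> R, r =o_\oo (fun n : nat => n%:R^-1 : R) /\
    \forall n \near \oo, ('E_P[X n])%E = (- (c / n%:R) + r n)%:E.
Proof.
move=> mX h; exists (fun n => Ex P (X n) + c / n%:R); split.
  exact: o3_littleo.
exists 4%N => // n /= n3.
by rewrite (expectation_Ex (mX n n3)) [- _ + _]addrC addrK.
Qed.

Theorem mainTheorem1 (R : realType) (d : measure_display)
    (T : measurableType d) (P : probability T R)
    (phi1 phi2 sigma : R) (z a : int -> {RV P >-> R})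
    (hphi2 : `|phi2| < 1) (hsum : phi1 + phi2 < 1) (hdiff : phi2 - phi1 < 1)
    (hsigma : 0 < sigma ^+ 2)
    (hz : causal_stationary_AR2 phi1 phi2 sigma z a) :
  (exists r1 : nat -> R,
     r1 =o_\oo (fun n : nat => n%:R^-1 : R) /\
     \forall n \near \oo,
       ('E_P[fun w => (burg_phi1 (fun t => z t w) n - phi1)%R])%E
       = (- (phi1 / n%:R) + r1 n)%:E) /\
  (exists r2 : nat -> R,
     r2 =o_\oo (fun n : nat => n%:R^-1 : R) /\
     \forall n \near \oo,
       ('E_P[fun w => (burg_phi2 (fun t => z t w) n - phi2)%R])%E
       = (- ((1 + 3 * phi2) / n%:R) + r2 n)%:E).
Proof.
have [mu [g0 [g1 [g2 M]]]] := causal_AR2_model hphi2 hsum hdiff hsigma hz.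
have hrho := normr_reflection_lt1 hphi2 hsum hdiff.
split; apply: bias_expansion.
- move=> n n3; apply: momD; last exact: mom_cst.
  exact: (mom_burg_phi1 M).
- exact: (burg_phi1_bias M).
- move=> n n3; apply: momD; last exact: mom_cst.
  exact: (mom_burg_phi2 M).
- exact: (burg_phi2_bias M).
Qed.
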